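(* Let $(M^n,g)$ be an $n$-dimensional Riemannian manifold and let $k$ be an integer with $1\leq k\leq n/2$. Suppose that $M$ has $\alpha$-nonnegative or $\alpha$-nonpositive curvature operator of the second kind for some $$\alpha<k(n-k)+\frac{2k(n-k)}{n}.$$ Then $M$ cannot locally split off a $k$-dimensional factor, unless it is flat; that is, if $M$ locally splits off a $k$-dimensional factor, then $M$ is flat.
   Context: All manifolds are connected. ''$M$ locally splits off a $k$-dimensional factor'' means that each point of $M$ has a neighborhood isometric to a Riemannian product $(M_1^{k}\times M_2^{n-k},g_1\oplus g_2)$ of Riemannian manifolds of dimensions $k$ and $n-k$. The sign convention for the Riemann curvature tensor is that $R_{ijij}$ is the sectional curvature of the plane spanned by orthonormal $e_i,e_j$. For $p\in M$, $S^2_0(T_pM)$ is the space of traceless symmetric two-tensors on $T_pM$, of dimension $N=\frac{(n-1)(n+2)}{2}$. The curvature operator of the second kind at $p$ is the symmetric bilinear form on $S^2_0(T_pM)$ given, in an orthonormal basis of $T_pM$, by $\mathring{R}(\varphi,\psi)=\sum_{i,j,k,l}R_{ijkl}\varphi_{il}\psi_{jk}$. For real $\alpha\in[1,N]$, $M$ has $\alpha$-nonnegative (respectively, $\alpha$-nonpositive) curvature operator of the second kind if for every $p\in M$ and every orthonormal basis $\{\varphi_i\}_{i=1}^N$ of $S^2_0(T_pM)$, $$\sum_{i=1}^{\lfloor\alpha\rfloor}\mathring{R}(\varphi_i,\varphi_i)+(\alpha-\lfloor\alpha\rfloor)\mathring{R}(\varphi_{\lfloor\alpha\rfloor+1},\varphi_{\lfloor\alpha\rfloor+1})\geq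 0\quad(\text{respectively, }\leq 0),$$ the last term being omitted when $\alpha=N$. *)

(* Defs.v *)
From HB Require Import structures.
From mathcomp Require Import all_boot all_order all_algebra.
From mathcomp Require Import all_classical all_reals all_analysis.
Set Implicit Arguments.
Unset Strict Implicit.
Unset Printing Implicit Defensive.
Import Order.TTheory GRing.Theory Num.Theory.
Import numFieldNormedType.Exports.
Local Open Scope classical_set_scope.
Local Open Scope ring_scope.

(* [C^oo] on [A], only meant for open sets [A]: iterated directional
   derivatives of every order exist and are Frechet differentiable on [A]. *)
Definition smooth_on (R : realType) (V W : normedModType R)
    (A : set V) (f : V -> W) : Prop :=
  forall (s : seq V) (x : V), A x ->
    differentiable (foldr (fun v g => 'D_v g) f s) x.

(* A topological space with an atlas and, in each chart, the matrix
   [(g_ij)] of a metric; the axioms are in [is_riemannian].  [chart i] is only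
   meaningful on [chart_dom i], and [chart_inv i], [metric i] only on the image
   [chart i @` chart_dom i] of the chart. *)
Record riemann_data (R : realType) (n : nat) := RiemannData {
  points :> topologicalType ;
  chart_index : Type ;
  chart_dom : chart_index -> set points ;
  chart : chart_index -> points -> 'rV[R]_n ;
  chart_inv : chart_index -> 'rV[R]_n -> points ;
  metric : chart_index -> 'rV[R]_n -> 'M[R]_n }.

(* The expression of [f : M -> N] in the charts [i] of [M] and [j] of [N]. *)
Definition in_charts (R : realType) (n m : nat)
    (M : riemann_data R n) (N : riemann_data R m) (f : M -> N)
    (i : chart_index M) (j : chart_index N) : 'rV[R]_n -> 'rV[R]_m :=
  fun x => chart j (f (chart_inv i x)).

(* Tangent vectors are row vectors and [jacobian] acts on them on the right,
   so the pull-back of the Gram matrix [h] along a map with Jacobian [J] is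
   [J *m h *m J^T]. *)
Definition pullback_metric (R : realType) (n m : nat)
    (F : 'rV[R]_n -> 'rV[R]_m) (h : 'rV[R]_m -> 'M[R]_m) : 'rV[R]_n -> 'M[R]_n :=
  fun x => jacobian F x *m h (F x) *m (jacobian F x)^T.

Record is_riemannian (R : realType) (n : nat) (M : riemann_data R n) : Prop :=
  IsRiemannian {
    riem_hausdorff : hausdorff_space M ;
    riem_second_countable : @second_countable M ;
    riem_connected : connected [set: M] ;
    riem_cover : forall p : M, exists i, chart_dom i p ;
    riem_dom_open : forall i : chart_index M, open (chart_dom i) ;
    riem_image_open : forall i : chart_index M,
      open (chart i @` chart_dom i) ;
    riem_chartK : forall (i : chart_index M) (p : M),
      chart_dom i p -> chart_inv i (chart i p) = p ;
    riem_chart_continuous : forall (i : chart_index M) (p : M),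
      chart_dom i p -> {for p, continuous (chart i)} ;
    riem_chart_inv_continuous : forall (i : chart_index M) (x : 'rV[R]_n),
      (chart i @` chart_dom i) x -> {for x, continuous (chart_inv i)} ;
    riem_transition_smooth : forall i j : chart_index M,
      smooth_on (chart i @` (chart_dom i `&` chart_dom j))
                (in_charts (fun p : M => p) i j) ;
    riem_metric_smooth : forall i : chart_index M,
      smooth_on (chart i @` chart_dom i) (metric i) ;
    riem_metric_sym : forall (i : chart_index M) (x : 'rV[R]_n),
      (chart i @` chart_dom i) x -> (metric i x)^T = metric i x ;
    riem_metric_posdef : forall (i : chart_index M) (x v : 'rV[R]_n),
      (chart i @` chart_dom i) x -> v != 0 ->
      0 < (v *m metric i x *m v^T) 0 0 ;
    riem_metric_compat : forall (i j : chart_index M) (x : 'rV[R]_n),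
      (chart i @` (chart_dom i `&` chart_dom j)) x ->
      metric i x =
        pullback_metric (in_charts (fun p : M => p) i j) (metric j) x }.

Definition prod_riemann (R : realType) (n1 n2 : nat)
    (M1 : riemann_data R n1) (M2 : riemann_data R n2) :
    riemann_data R (n1 + n2) :=
  @RiemannData R (n1 + n2) (M1 * M2)%type
    (chart_index M1 * chart_index M2)%type
    (fun i => chart_dom i.1 `*` chart_dom i.2)
    (fun i p => row_mx (chart i.1 p.1) (chart i.2 p.2))
    (fun i x => (chart_inv i.1 (lsubmx x), chart_inv i.2 (rsubmx x)))
    (fun i x => block_mx (metric i.1 (lsubmx x)) 0 0 (metric i.2 (rsubmx x))).

Definition smooth_map_on (R : realType) (n m : nat)
    (M : riemann_data R n) (N : riemann_data R m)
    (U : set M) (f : M -> N) : Prop :=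
  (forall p, U p -> {for p, continuous f}) /\
  (forall (i : chart_index M) (j : chart_index N),
     smooth_on (chart i @` (U `&` chart_dom i `&` f @^-1` chart_dom j))
               (in_charts f i j)).

(* The open subset [U] of [M] is isometric to the whole of [N].  The two
   dimensions are kept apart so that no cast is needed for
   [n = k + (n - k)]. *)
Definition isometric (R : realType) (n m : nat)
    (M : riemann_data R n) (U : set M) (N : riemann_data R m) : Prop :=
  exists (f : M -> N) (h : N -> M),
    [/\ (forall p, U p -> h (f p) = p),
        (forall q, U (h q) /\ f (h q) = q),
        smooth_map_on U f,
        smooth_map_on [set: N] h &
        forall (i : chart_index M) (j : chart_index N) (x : 'rV[R]_n),
          (chart i @` (U `&` chart_dom i `&` f @^-1` chart_dom j)) x ->
          metric i x = pullback_metric (in_charts f i j) (metric j) x].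

Definition locally_splits (R : realType) (n : nat) (M : riemann_data R n)
    (k : nat) : Prop :=
  forall p : M, exists U : set M,
    [/\ open U, U p &
        exists (M1 : riemann_data R k) (M2 : riemann_data R (n - k)),
          [/\ is_riemannian M1, is_riemannian M2 &
              isometric U (prod_riemann M1 M2)]].

Section Curvature.
Variables (R : realType) (n : nat) (g : 'rV[R]_n -> 'M[R]_n).

Definition partial (a : 'I_n) (f : 'rV[R]_n -> R) : 'rV[R]_n -> R :=
  'D_(delta_mx 0 a) f.

(* [christoffel a b c] is [Gamma_{ab}^c]. *)
Definition christoffel (a b c : 'I_n) (x : 'rV[R]_n) : R :=
  2^-1 * \sum_(d < n) invmx (g x) c d *
    (partial a (fun y => g y b d) x + partial b (fun y => g y a d) x
     - partial d (fun y => g y a b) x).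

(* The [d]-th component of [R(X_a, X_b) X_c], where [X_a] is the [a]-th
   coordinate vector field and
   [R(X, Y) Z = nabla_X nabla_Y Z - nabla_Y nabla_X Z - nabla_[X,Y] Z]. *)
Definition curvature_mixed (a b c d : 'I_n) (x : 'rV[R]_n) : R :=
  partial a (christoffel b c d) x - partial b (christoffel a c d) x
  + \sum_(e < n) (christoffel b c e x * christoffel a e d x
                  - christoffel a c e x * christoffel b e d x).

(* [R_{abcd} = g(R(X_a, X_b) X_d, X_c)]; with this sign [R_{abab}] is the
   sectional curvature of the plane spanned by orthonormal [X_a], [X_b]. *)
Definition riemann_tensor (a b c d : 'I_n) (x : 'rV[R]_n) : R :=
  \sum_(e < n) g x c e * curvature_mixed a b d e x.

(* The rows of [E] form a basis of the tangent space at [x], orthonormal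
   for [g x]. *)
Definition orthonormal_frame (x : 'rV[R]_n) (E : 'M[R]_n) : Prop :=
  E *m g x *m E^T = 1%:M.

Definition riemann_in_frame (E : 'M[R]_n) (x : 'rV[R]_n)
    (a b c d : 'I_n) : R :=
  \sum_(p < n) \sum_(q < n) \sum_(r < n) \sum_(s < n)
    E a p * E b q * E c r * E d s * riemann_tensor p q r s x.

End Curvature.

Section SecondKind.
Variables (R : realType) (n : nat).

(* Symmetric two-tensors on the tangent space are given by their components
   in an orthonormal frame; the trace and the inner product of tensors are then
   those of matrices. *)
Definition S20 : {vspace 'M[R]_n} :=
  (lker (linfun (fun A : 'M[R]_n => A - A^T)) :&:
   lker (linfun (fun A : 'M[R]_n => \tr A : R^o)))%VS.

Lemma mem_S20 (A : 'M[R]_n) : (A \in S20) = (A^T == A) && (\tr A == 0).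
Proof.
rewrite memv_cap !memv_ker.
have l1 : linear (fun A : 'M[R]_n => A - A^T).
  by move=> a u v; rewrite linearP /= scalerBr opprD addrACA.
have l2 : linear (fun A : 'M[R]_n => \tr A : R^o).
  by move=> a u v; rewrite linearP.
pose h1 := HB.pack_for {linear 'M[R]_n -> 'M[R]_n} (fun A : 'M[R]_n => A - A^T)
  (GRing.isLinear.Build _ _ _ _ _ l1).
pose h2 := HB.pack_for {linear 'M[R]_n -> R^o} (fun A : 'M[R]_n => \tr A : R^o)
  (GRing.isLinear.Build _ _ _ _ _ l2).
by rewrite (lfunE h1) (lfunE h2) /= subr_eq0 eq_sym.
Qed.

Definition dimS20 : nat := ((n.-1 * n.+2)./2)%N.

Definition tensor_dot (phi psi : 'M[R]_n) : R := \sum_i \sum_j phi i j * psi i j.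

Definition orthonormal_basis_S20 (phi : dimS20.-tuple 'M[R]_n) : Prop :=
  basis_of S20 phi /\
  forall i j : 'I_dimS20, tensor_dot (tnth phi i) (tnth phi j) = (i == j)%:R.

Definition second_kind (Rm : 'I_n -> 'I_n -> 'I_n -> 'I_n -> R)
    (phi psi : 'M[R]_n) : R :=
  \sum_(i < n) \sum_(j < n) \sum_(k < n) \sum_(l < n)
    Rm i j k l * phi i l * psi j k.

(* Indices start at 0, so the term with index [floor alpha + 1] is the one with
   ordinal [Num.truncn alpha]; the second sum is empty when
   [alpha = dimS20]. *)
Definition alpha_sum (alpha : R) (Rm : 'I_n -> 'I_n -> 'I_n -> 'I_n -> R)
    (phi : dimS20.-tuple 'M[R]_n) : R :=
  \sum_(i < dimS20 | (i < Num.truncn alpha)%N)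
     second_kind Rm (tnth phi i) (tnth phi i)
  + (alpha - (Num.truncn alpha)%:R) *
    \sum_(i < dimS20 | nat_of_ord i == Num.truncn alpha)
       second_kind Rm (tnth phi i) (tnth phi i).

End SecondKind.

(* Neither the form on the tangent space at a point nor the flatness condition
   depends on the chart and the orthonormal frame used to compute it, so all
   of them are quantified over. *)
Definition alpha_nonnegative (R : realType) (n : nat) (M : riemann_data R n)
    (alpha : R) : Prop :=
  forall (p : M) (i : chart_index M) (E : 'M[R]_n)
         (phi : (dimS20 n).-tuple 'M[R]_n),
    chart_dom i p ->
    orthonormal_frame (metric i) (chart i p) E ->
    orthonormal_basis_S20 phi ->
    0 <= alpha_sum alpha (riemann_in_frame (metric i) E (chart i p)) phi.

Definition alpha_nonpositive (R : realType) (n : nat) (M : riemann_data R n)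
    (alpha : R) : Prop :=
  forall (p : M) (i : chart_index M) (E : 'M[R]_n)
         (phi : (dimS20 n).-tuple 'M[R]_n),
    chart_dom i p ->
    orthonormal_frame (metric i) (chart i p) E ->
    orthonormal_basis_S20 phi ->
    alpha_sum alpha (riemann_in_frame (metric i) E (chart i p)) phi <= 0.

Definition flat (R : realType) (n : nat) (M : riemann_data R n) : Prop :=
  forall (p : M) (i : chart_index M) (a b c d : 'I_n),
    chart_dom i p -> riemann_tensor (metric i) a b c d (chart i p) = 0.

(* Main.v *)
Require Import Defs.
From HB Require Import structures.
From mathcomp Require Import all_boot all_order all_algebra.
From mathcomp Require Import all_classical all_reals all_analysis.
From mathcomp Require Import ring lra zify.
Set Implicit Arguments.
Unset Strict Implicit.
Unset Printing Implicit Defensive.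
Import Order.TTheory GRing.Theory Num.Theory.
Import numFieldNormedType.Exports.
Local Open Scope classical_set_scope.
Local Open Scope ring_scope.

(** At a point where the metric splits, the curvature tensor is the
    sum of the curvature tensors of the two factors, of dimensions [k] and [l] with
    [k + l = n].  Fix an orthonormal frame adapted to the splitting and write
    [K a b] for the sectional curvatures.  The curvature operator of the second
    kind takes the value [K a b] on the unit traceless tensor spanned by the
    symmetric product of [e_a] and [e_b], hence zero if the two vectors come from
    different factors, and on the unit multiple of [l g1 - k g2] it takes the value
    [- (l^2 S1 + k^2 S2) / (k l n)], where [S1] and [S2] are the scalar curvatures.
    Give weight 1 to the [k l] mixed tensors and to the last one, weight
    [2 l / (k n)] to the products inside the first factor and [2 k / (l n)] to
    those inside the second.  Then the weighted sum of the values is zero and the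
    total weight is exactly [k l + 2 k l / n].

    A nonnegative alpha-sum over every orthonormal basis gives a nonnegative weighted
    sum for all weights in [0, 1] on an orthonormal family whose total is at least
    alpha ([alpha_sum_of_sorted_ge0], [family_weighted_sum_ge0]; the family is
    completed to a basis by the Gram-Schmidt process).  Since alpha is smaller
    than the total above, any one weight can be lowered a little, which shows that
    each of the values is nonpositive; as their weighted sum is zero, they all vanish
    ([split_sectional_eq0]).  This holds in every adapted frame, so all sectional
    curvatures of both factors vanish, and by polarization both factors are flat
    ([sectional_zero_curvature_zero]).  The nonpositive case is the same argument
    for the opposite tensor.

    The geometric input is that the curvature computed in a chart of the manifold is
    the pull-back of the curvature of the product.  In matrix notation the Christoffel
    symbols form a connection, characterized by its symmetry and its compatibility
    with the metric ([connection_unique]).  This yields the transformation law as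
    a change of gauge by the Jacobian ([connection_pullback]); differentiating it
    once, with symmetric second derivatives ([schwarz]), gives the
    tensoriality of the curvature ([riemann_tensor_pullback]).  The same
    characterization identifies the connection of a product metric as block diagonal,
    and its curvature as a sum ([riemann_tensor_prod]). *)

(** * Orthonormal systems *)

Section GramSchmidt.
Variables (R : realType) (V : vectType R) (dot : V -> V -> R).
Hypothesis dotDl : forall a u v w, dot (a *: u + v) w = a * dot u w + dot v w.
Hypothesis dotC : forall u v, dot u v = dot v u.
Hypothesis dot_gt0 : forall u, u != 0 -> 0 < dot u u.

(** Pairwise orthogonality is indexed by the vectors themselves and not by
    positions, so that permuting a system or enlarging it stays trivial. *)
Definition orthonormal (X : seq V) : Prop :=
  uniq X /\ {in X &, forall x y, dot x y = (x == y)%:R}.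

Let dot0l w : dot 0 w = 0.
Proof. by have := dotDl 1 0 0 w; rewrite scale1r addr0; lra. Qed.

Let dotZl a u w : dot (a *: u) w = a * dot u w.
Proof. by have := dotDl a u 0 w; rewrite addr0 dot0l addr0. Qed.

Let dot_suml (I : Type) (r : seq I) (F : I -> V) w :
  dot (\sum_(i <- r) F i) w = \sum_(i <- r) dot (F i) w.
Proof.
elim: r => [|i r IH]; first by rewrite !big_nil dot0l.
by rewrite !big_cons -{1}[F i]scale1r dotDl mul1r IH.
Qed.

Lemma orthonormal_free X : orthonormal X -> free X.
Proof.
move=> [uX oX]; have -> : free X = free (in_tuple X) by []; apply/freeP => k k0 i.
have := congr1 (fun v => dot v X`_i) k0; rewrite dot0l dot_suml => <-.
rewrite (bigD1 i) //= dotZl oX ?mem_nth // eqxx mulr1 big1 ?addr0 // => j ji.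
by rewrite dotZl oX ?mem_nth // nth_uniq // val_eqE (negbTE ji) mulr0.
Qed.

(** One Gram-Schmidt step: a vector of [U] outside the span of [X], minus its
    projection to that span, is nonzero and can be normalized. *)
Lemma orthonormal_cons (U : {vspace V}) X :
  {subset X <= U} -> orthonormal X -> (size X < \dim U)%N ->
  exists2 x, x \in U & orthonormal (x :: X).
Proof.
move=> XU oX szX.
have /subvPn[v vU vX] : ~~ (U <= <<X>>)%VS.
  apply: contraL szX => /dimvS; rewrite -leqNgt => /leq_trans; apply.
  exact: dim_span.
have [uX dX] := oX.
pose w := v - \sum_(x <- X) dot v x *: x.
have wU : w \in U.
  by rewrite memvB // big_seq memv_suml // => x xX; rewrite memvZ // XU.
have w0 : w != 0.
  apply: contraNneq vX => /eqP; rewrite subr_eq0 => /eqP ->.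
  by rewrite big_seq memv_suml // => x xX; rewrite memvZ // memv_span.
have wX x : x \in X -> dot w x = 0.
  move=> xX; rewrite /w addrC -scaleN1r dotDl dot_suml (big_rem x) //= dotZl (dX x x) //.
  rewrite eqxx mulr1 big_seq big1 ?addr0 ?mulN1r ?addNr // => y yX.
  rewrite dotZl (dX y x) //; last exact: mem_rem yX.
  case: eqP yX => [->|]; last by rewrite mulr0.
  by rewrite (rem_filter _ uX) mem_filter /= eqxx.
pose c := Num.sqrt (dot w w).
have c0 : 0 < c by rewrite sqrtr_gt0 dot_gt0.
have xx : dot (c^-1 *: w) (c^-1 *: w) = 1.
  rewrite dotZl dotC dotZl mulrA -expr2 exprVn sqr_sqrtr ?ltW ?dot_gt0 //.
  by rewrite mulVf // gt_eqF ?dot_gt0.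
have xX y : y \in X -> dot (c^-1 *: w) y = 0.
  by move=> yX; rewrite dotZl wX ?mulr0.
exists (c^-1 *: w); first exact: memvZ.
have nX : c^-1 *: w \notin X.
  by apply/negP => /xX; rewrite xx => /eqP; rewrite oner_eq0.
split=> [|a b]; first by rewrite /= nX.
rewrite !inE => /predU1P[->|aX] /predU1P[->|bX].
- by rewrite eqxx xx.
- by rewrite xX //; case: eqP bX nX => // <- ->.
- by rewrite dotC xX //; case: eqP aX nX => // -> ->.
- exact: dX.
Qed.

Lemma orthonormal_complete (U : {vspace V}) X :
  {subset X <= U} -> orthonormal X ->
  exists Y, [/\ {subset X <= Y}, orthonormal Y & basis_of U Y].
Proof.
have [m] := ubnP (\dim U - size X); elim: m X => // m IH X.
rewrite ltnS => le_m XU oX; have fX := orthonormal_free oX.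
have [szX|szX] := ltnP (size X) (\dim U); last first.
  exists X; split=> //; rewrite basisEfree fX szX andbT.
  by apply/span_subvP.
have [x xU oxX] := orthonormal_cons XU oX szX.
have [||//|Y [XY oY bY]] := IH (x :: X).
- by rewrite /=; move: szX le_m => /=; rewrite -subn_gt0 subnS; case: (_ - _)%N.
- by move=> y; rewrite inE => /predU1P[->//|]; apply: XU.
- by exists Y; split=> // y yX; apply: XY; rewrite inE yX orbT.
Qed.

End GramSchmidt.

(** * Partial sums of an ordered list and weighted sums *)

Lemma sum_ltn (n m : nat) : (m <= n)%N -> (\sum_(i < n) (i < m)%N = m)%N.
Proof.
move=> mn; rewrite -[RHS]card_ord -sum1_card (big_ord_widen n (fun=> 1%N) mn).
by rewrite [RHS]big_mkcond; apply: eq_bigr => i _; case: ltnP.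
Qed.

(** Counting by the larger element gives the sum of the first integers. *)
Lemma sum_ltn_pairs (n : nat) : (\sum_(p : 'I_n * 'I_n) (p.1 < p.2)%N = 'C(n, 2))%N.
Proof.
rewrite -(pair_bigA _ (fun a b : 'I_n => (a < b)%N : nat)) exchange_big /=.
rewrite -bin2_sum big_mkord; apply: eq_bigr => b _.
by rewrite sum_ltn // ltnW.
Qed.

Section Weights.
Variable R : realType.

(** [alpha_sum] for an arbitrary list of values; [alpha_sum alpha Rm phi] unfolds
    to it for the diagonal values of the curvature operator of the second kind. *)
Definition alpha_sum_of (N : nat) (alpha : R) (r : 'I_N -> R) : R :=
  \sum_(i < N | (i < Num.truncn alpha)%N) r i
  + (alpha - (Num.truncn alpha)%:R) *
    \sum_(i < N | nat_of_ord i == Num.truncn alpha) r i.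

(** The alpha-sum of an increasing list is the smallest value of a weighted sum
    with weights in [0, 1] and total weight alpha: weight moved to another index
    crosses the value [t] at position floor(alpha) upwards.  A larger total weight
    does not hurt because [t] cannot be negative, all values up to [t] being then
    negative while their alpha-sum is not. *)
Lemma alpha_sum_of_sorted_ge0 (N : nat) (alpha : R) (r w : 'I_N -> R) :
  {homo r : i j / (i <= j)%N >-> i <= j} ->
  1 <= alpha -> alpha <= N%:R ->
  0 <= alpha_sum_of alpha r ->
  (forall i, 0 <= w i <= 1) -> alpha <= \sum_i w i ->
  0 <= \sum_i w i * r i.
Proof.
move=> r_homo a1 aN ps_ge0 w01 aw.
set fl := Num.truncn alpha in ps_ge0.
have a0 : 0 <= alpha by lra.
have /andP[fl_le fl_gt] : fl%:R <= alpha < fl.+1%:R by exact: truncn_itv.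
have N0 : (0 < N)%N by rewrite -(ltr_nat R); lra.
have flN : (fl <= N)%N by rewrite -(ler_nat R) (le_trans fl_le).
(* For alpha = N there is no index floor(alpha), and the last value replaces it. *)
have mN : (minn fl N.-1 < N)%N by rewrite gtn_min prednK ?leqnn ?orbT.
pose t := r (Ordinal mN).
(* The weights that turn the alpha-sum into a weighted sum. *)
pose v (i : 'I_N) : R :=
  (i < fl)%N%:R + (alpha - fl%:R) * (nat_of_ord i == fl)%:R.
have vr : alpha_sum_of alpha r = \sum_i v i * r i.
  rewrite /alpha_sum_of big_mkcond [X in _ + _ * X]big_mkcond mulr_sumr -big_split.
  apply: eq_bigr => i _; rewrite /v /= -/fl; case: (i < fl)%N; case: (_ == fl) => /=; ring.
have va : \sum_i v i = alpha.
  rewrite /v big_split -mulr_sumr /= -!natr_sum.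
  have -> : (\sum_(i < N) (i < fl)%N = fl)%N.
    exact: sum_ltn.
  move: flN; rewrite leq_eqVlt => /predU1P[flN|flN].
    have -> : alpha = fl%:R by apply/le_anti; rewrite fl_le flN aN.
    by ring.
  rewrite (bigD1 (Ordinal flN)) //= eqxx big1 ?addn0 ?mulr1; first by ring.
  by move=> i; rewrite -val_eqE /= => /negbTE->.
have r_le (i : 'I_N) : (i <= fl)%N -> r i <= t.
  by move=> ifl; apply: r_homo; rewrite /= leq_min ifl /= -ltnS prednK.
have v_le i : v i * r i <= v i * t.
  rewrite /v; case: (ltngtP i fl) => [/ltnW/r_le rit|_|ifl] /=; first by rewrite mulr0 addr0 !mul1r.
    by rewrite !(mulr0, addr0, mul0r).
  have := r_le i; rewrite ifl leqnn => /(_ isT) rit; nra.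
have t0 : 0 <= t.
  have : \sum_i v i * r i <= alpha * t by rewrite -va mulr_suml ler_sum.
  by rewrite -vr => ?; nra.
have H i : v i * (r i - t) <= w i * (r i - t).
  have /andP[w0 w1] := w01 i; rewrite /v.
  case: (ltngtP i fl) => [/ltnW/r_le rit|ifl|ifl] /=; first by nra.
    have : t <= r i by apply: r_homo; rewrite (leq_trans (geq_minl _ _) (ltnW ifl)).
    by move=> ?; nra.
  have -> : r i = t.
    congr r; apply: val_inj => /=; rewrite -ifl; apply/esym/minn_idPl.
    by rewrite -ltnS prednK.
  by rewrite subrr !mulr0.
have : \sum_i v i * (r i - t) <= \sum_i w i * (r i - t) by apply: ler_sum.
under eq_bigr do rewrite mulrBr; under [X in _ <= X]eq_bigr do rewrite mulrBr.
rewrite !sumrB -!mulr_suml -vr va => ?; nra.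
Qed.

End Weights.

(** * The dimension of the space of traceless symmetric matrices *)

Section TracelessDimension.
Variables (R : realType) (n : nat) (o : 'I_n).

(** The entries on or above the diagonal determine a symmetric matrix, and the
    trace determines the entry [(o, o)] from the others, so these positions index
    a basis. *)
Definition S20_index : pred ('I_n * 'I_n) :=
  fun p => (p.1 < p.2)%N || ((p.1 == p.2) && (p.1 != o)).

(** The basis dual to the entries at the positions in [S20_index]. *)
Definition S20_vector (p : 'I_n * 'I_n) : 'M[R]_n :=
  if p.1 == p.2 then delta_mx p.1 p.1 - delta_mx o o
  else delta_mx p.1 p.2 + delta_mx p.2 p.1.

Lemma S20_vector_mem p : S20_vector p \in S20 R n.
Proof.
rewrite mem_S20 /S20_vector; case: (eqVneq p.1 p.2) => [_|p12].
  rewrite raddfB /= !trmx_delta eqxx /= raddfB /= /mxtrace.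
  rewrite (bigD1 p.1) //= big1 => [|i /negbTE ip]; last by rewrite mxE ip.
  rewrite mxE !eqxx (bigD1 o) //= big1 => [|i /negbTE io]; last by rewrite mxE io.
  by rewrite mxE !eqxx subrr.
rewrite raddfD /= !trmx_delta addrC eqxx /= /mxtrace big1 // => i _.
rewrite !mxE; case: (eqVneq i p.1) => [->|_] /=; first by rewrite (negbTE p12) addr0.
by case: (eqVneq i p.2) => //=; rewrite addr0.
Qed.

Lemma S20_vector_entry p a b : S20_index p -> S20_index (a, b) ->
  S20_vector p a b = (p == (a, b))%:R.
Proof.
case: p => c d; rewrite /S20_index /S20_vector /= xpair_eqE.
case: (eqVneq c d) => [->|cd] /= Hp Hab.
  rewrite !mxE [a == d]eq_sym [b == d]eq_sym.
  suff -> : (a == o) && (b == o) = false by rewrite subr0.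
  by apply/andP => -[/eqP ao /eqP bo]; move: Hab; rewrite ao bo ltnn eqxx.
rewrite !mxE [a == c]eq_sym [b == d]eq_sym.
suff -> : (a == d) && (b == c) = false by rewrite addr0.
apply/andP => -[/eqP ad /eqP bc]; move: Hab Hp.
by rewrite ad bc [d == c]eq_sym (negbTE cd) !orbF => /ltnW; rewrite leqNgt => /negbTE->.
Qed.

Lemma S20_index_card : #|S20_index| = dimS20 n.
Proof.
rewrite -sum1_card big_mkcond /=.
transitivity (\sum_(p : 'I_n * 'I_n) ((p.1 < p.2)%N + ((p.1 == p.2) && (p.1 != o))))%N.
  apply: eq_bigr => -[a b] _; rewrite unfold_in /S20_index /=.
  by case: (eqVneq a b) => [->|_]; rewrite ?ltnn ?orbF /=; case: ifP.
rewrite big_split /= sum_ltn_pairs.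
rewrite -(pair_bigA _ (fun a b : 'I_n => ((a == b) && (a != o)) : nat)) /=.
have -> : (\sum_(i < n) \sum_(j < n) ((i == j) && (i != o)) = n.-1)%N.
  rewrite -[in RHS](card_ord n) -(cardC1 o) -sum1_card [RHS]big_mkcond.
  apply: eq_bigr => i _; rewrite (bigD1 i) //= eqxx big1.
    by rewrite addn0 inE; case: (i != o).
  by move=> j /negbTE ji; rewrite [i == j]eq_sym ji.
have : (0 < n)%N by apply: leq_trans (ltn_ord o).
case: n => // m _; rewrite /dimS20 bin2 /=.
have -> : (m * m.+3 = m.+1 * m + m.*2)%N by rewrite -muln2; ring.
by rewrite halfD odd_double andbF doubleK.
Qed.

(** The definition of alpha-nonnegativity only sees bases of exactly [dimS20 n]
    vectors; this equality is what makes it non-vacuous. *)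
Lemma dim_S20 : \dim (S20 R n) = dimS20 n.
Proof.
pose X := map_tuple S20_vector (enum_tuple S20_index).
have X_nth (i : 'I_#|S20_index|) : X`_i = S20_vector (enum_val i).
  by rewrite /= (nth_map (enum_val i)) -?enum_val_nth -?cardE.
have XS : (<<X>> <= S20 R n)%VS.
  by apply/span_subvP => x /mapP[p _ ->]; apply: S20_vector_mem.
have X_entry (i j : 'I_#|S20_index|) :
    (X`_i : 'M[R]_n) (enum_val j).1 (enum_val j).2 = (i == j)%:R.
  have Pi : S20_index (enum_val i) := enum_valP i.
  have Pj : S20_index (enum_val j) := enum_valP j.
  by rewrite X_nth S20_vector_entry -?surjective_pairing ?(inj_eq enum_val_inj).
have fX : free X.
  apply/freeP => c c0 i.
  have := congr1 (fun A : 'M[R]_n => A (enum_val i).1 (enum_val i).2) c0.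
  rewrite summxE mxE (bigD1 i) //= mxE X_entry eqxx mulr1 big1 ?addr0 // => j ji.
  by rewrite mxE X_entry (negbTE ji) mulr0.
have SX : (S20 R n <= <<X>>)%VS.
  apply/subvP => A AS; pose B := A - \sum_(p | S20_index p) A p.1 p.2 *: S20_vector p.
  have BX : A - B \in <<X>>%VS.
    rewrite /B opprB addrC subrK memv_suml // => p Pp; rewrite memvZ // memv_span //.
    by apply: map_f; rewrite mem_enum.
  suff B0 : B = 0 by move: BX; rewrite B0 subr0.
  have BS : B \in S20 R n.
    by rewrite memvB // memv_suml // => p _; rewrite memvZ // S20_vector_mem.
  move: BS; rewrite mem_S20 => /andP[/eqP BT /eqP Btr].
  have BP a b : S20_index (a, b) -> B a b = 0.
    move=> Pab; rewrite !mxE summxE (bigD1 (a, b)) //= mxE S20_vector_entry // eqxx.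
    rewrite mulr1 big1 ?addr0 ?subrr // => p /andP[Pp pab].
    by rewrite mxE S20_vector_entry // (negbTE pab) mulr0.
  have Boff a b : (a, b) != (o, o) -> B a b = 0.
    rewrite xpair_eqE negb_and => ab; case: (ltngtP a b) => [lt_ab|lt_ba|/val_inj ab_eq].
    - by rewrite BP // /S20_index /= lt_ab.
    - by rewrite -BT mxE BP // /S20_index /= lt_ba.
    - by rewrite BP // /S20_index /= ab_eq eqxx; move: ab; rewrite ab_eq orbb => ->; rewrite orbT.
  apply/matrixP => a b; rewrite [RHS]mxE; have [[-> ->]|/Boff//] := eqVneq (a, b) (o, o).
  move: Btr; rewrite /mxtrace (bigD1 o) //= big1 ?addr0 // => i io.
  by rewrite Boff // xpair_eqE negb_and io.
have -> : S20 R n = <<X>>%VS by apply/eqP; rewrite eqEsubv SX XS.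
by rewrite (eqnP fX) size_tuple S20_index_card.
Qed.

End TracelessDimension.

Lemma tensor_dotDl (R : realType) n (a : R) (A B C : 'M[R]_n) :
  tensor_dot (a *: A + B) C = a * tensor_dot A C + tensor_dot B C.
Proof.
rewrite /tensor_dot mulr_sumr -big_split; apply: eq_bigr => i _ /=.
rewrite mulr_sumr -big_split; apply: eq_bigr => j _ /=; rewrite !mxE; ring.
Qed.

Lemma tensor_dotC (R : realType) n (A B : 'M[R]_n) : tensor_dot A B = tensor_dot B A.
Proof. by apply: eq_bigr => i _; apply: eq_bigr => j _; rewrite mulrC. Qed.

Lemma tensor_dot_gt0 (R : realType) n (A : 'M[R]_n) : A != 0 -> 0 < tensor_dot A A.
Proof.
move=> A0; have s0 i : 0 <= \sum_j A i j * A i j.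
  by apply: sumr_ge0 => j _; rewrite -expr2 sqr_ge0.
rewrite lt_neqAle sumr_ge0 // andbT eq_sym; apply: contraNneq A0 => /eqP.
rewrite psumr_eq0 // => /allP H; apply/eqP/matrixP => i j; rewrite mxE.
have /= := H i (mem_index_enum _); rewrite psumr_eq0; last first.
  by move=> ? _; rewrite -expr2 sqr_ge0.
by move=> /allP/(_ j (mem_index_enum _)); rewrite mulf_eq0 orbb => /eqP.
Qed.

(** * From alpha-sums over bases to weighted sums over orthonormal families *)

Section AlphaSums.
Variables (R : realType) (n : nat) (alpha : R) (r : 'M[R]_n -> R).
Hypotheses (n0 : (0 < n)%N) (alpha_ge1 : 1 <= alpha).
Hypothesis alpha_le : alpha <= (dimS20 n)%:R.
Hypothesis sums_ge0 : forall phi : (dimS20 n).-tuple 'M[R]_n,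
  orthonormal_basis_S20 phi ->
  0 <= alpha_sum_of alpha (fun i => r (tnth phi i)).

(** A basis may be reordered, and in increasing order of the values of [r] its
    alpha-sum is the least weighted sum. *)
Lemma basis_weighted_sum_ge0 (Y : seq 'M[R]_n) (W : 'M[R]_n -> R) :
  orthonormal (@tensor_dot R n) Y -> basis_of (S20 R n) Y ->
  (forall A, 0 <= W A <= 1) -> alpha <= \sum_(A <- Y) W A ->
  0 <= \sum_(A <- Y) W A * r A.
Proof.
move=> [uY oY] bY W01.
pose le_r := relpre r (<=%R : rel R).
pose S := sort le_r Y.
have YS : perm_eq S Y by rewrite perm_sort.
rewrite -!(perm_big _ YS) /= => aW.
have szS : size S == dimS20 n.
  by rewrite (perm_size YS) -(size_basis (X := in_tuple Y) bY) (dim_S20 _ (Ordinal n0)).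
pose phi : (dimS20 n).-tuple 'M[R]_n := Tuple szS.
have phiP : orthonormal_basis_S20 phi.
  split=> [|i j]; first by rewrite (perm_basis _ YS).
  have phi_inj : injective (tnth phi) by apply/tuple_uniqP; rewrite sort_uniq.
  by rewrite oY -?(perm_mem YS) ?mem_tnth // (inj_eq phi_inj).
have sum_phi (f : 'M[R]_n -> R) : \sum_(A <- S) f A = \sum_i f (tnth phi i).
  exact: (big_tuple _ _ phi predT f).
rewrite sum_phi; apply: (alpha_sum_of_sorted_ge0 _ alpha_ge1 alpha_le (sums_ge0 phiP)) => //.
  move=> i j ij; rewrite !(tnth_nth 0) /=.
  have le_tr : transitive le_r by move=> ? ? ?; apply: le_trans.
  have le_xx : reflexive le_r by move=> ?; apply: lexx.
  have le_tot : total le_r by move=> ? ?; apply: le_total.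
  have szS' := eqP szS.
  by apply: (sorted_leq_nth le_tr le_xx 0 (sort_sorted le_tot Y)); rewrite ?inE ?szS'.
by rewrite -sum_phi.
Qed.

(** The form in which the curvature hypothesis is used: an orthonormal family is
    completed to a basis whose new vectors get weight zero. *)
Lemma family_weighted_sum_ge0 (I : finType) (P : pred I) (F : I -> 'M[R]_n)
    (w : I -> R) :
  (forall i, P i -> F i \in S20 R n) ->
  (forall i j, P i -> P j -> tensor_dot (F i) (F j) = (i == j)%:R) ->
  (forall i, P i -> 0 <= w i <= 1) -> alpha <= \sum_(i | P i) w i ->
  0 <= \sum_(i | P i) w i * r (F i).
Proof.
move=> FS oF w01 aw.
have injF : {in P &, injective F}.
  move=> i j Pi Pj Fij; apply/eqP; have := oF i j Pi Pj.
  by rewrite Fij oF // eqxx; case: eqP => // _ /eqP; rewrite oner_eq0.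
pose X := [seq F i | i <- enum P].
have [|||||Y [XY oY bY]] := @orthonormal_complete R 'M[R]_n (@tensor_dot R n) _ _ _ (S20 R n) X.
- exact: tensor_dotDl.
- exact: tensor_dotC.
- exact: tensor_dot_gt0.
- by move=> A /mapP[i]; rewrite mem_enum => Pi ->; apply: FS.
- split.
    rewrite map_inj_in_uniq ?enum_uniq // => i j.
    by rewrite !mem_enum; apply: injF.
  move=> A B /mapP[i]; rewrite mem_enum => Pi -> /mapP[j]; rewrite mem_enum => Pj ->.
  by rewrite oF // (inj_in_eq injF).
(* The basis is indexed by its vectors, so the weights are transported along F. *)
pose W (A : 'M[R]_n) : R := \sum_(i | P i) w i * (F i == A)%:R.
have WF i : P i -> W (F i) = w i.
  move=> Pi; rewrite /W (bigD1 i) //= eqxx mulr1 big1 ?addr0 // => j /andP[Pj ji].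
  by rewrite (inj_in_eq injF) // (negbTE ji) mulr0.
have W01 A : 0 <= W A <= 1.
  have [/existsP[i /andP[Pi /eqP<-]]|nE] := boolP [exists i, P i && (F i == A)].
    by rewrite WF // w01.
  rewrite /W big1 ?lexx ?ler01 // => i Pi.
  move: nE; rewrite negb_exists => /forallP/(_ i); rewrite Pi /= => /negbTE->.
  by rewrite mulr0.
have sumW (f : 'M[R]_n -> R) : \sum_(A <- Y) W A * f A = \sum_(i | P i) w i * f (F i).
  rewrite /W; under eq_bigr do rewrite mulr_suml.
  rewrite exchange_big /=; apply: eq_bigr => i Pi.
  have FY : F i \in Y by apply: XY; apply: map_f; rewrite mem_enum.
  rewrite (bigD1_seq (F i)) ?oY.1 //= eqxx mulr1 big1 ?addr0 // => A /negbTE.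
  by rewrite eq_sym => ->; rewrite mulr0 mul0r.
rewrite -sumW; apply: basis_weighted_sum_ge0 => //.
have := sumW (fun=> 1); under eq_bigr do rewrite mulr1.
by under [X in _ = X]eq_bigr do rewrite mulr1; move->.
Qed.

End AlphaSums.

(** * The curvature operator of the second kind *)

Section SecondKindForm.
Variables (R : realType) (n : nat) (T : 'I_n -> 'I_n -> 'I_n -> 'I_n -> R).

Lemma second_kindDl A B C : second_kind T (A + B) C = second_kind T A C + second_kind T B C.
Proof.
rewrite /second_kind; do 4! [rewrite -big_split; apply: eq_bigr => ? _ /=].
by rewrite mxE; ring.
Qed.

Lemma second_kindDr A B C : second_kind T C (A + B) = second_kind T C A + second_kind T C B.
Proof.
rewrite /second_kind; do 4! [rewrite -big_split; apply: eq_bigr => ? _ /=].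
by rewrite mxE; ring.
Qed.

Lemma second_kindZ a A : second_kind T (a *: A) (a *: A) = a ^+ 2 * second_kind T A A.
Proof.
rewrite /second_kind; do 4! [rewrite mulr_sumr; apply: eq_bigr => ? _ /=].
by rewrite !mxE; ring.
Qed.

Lemma second_kind_delta a b c d :
  second_kind T (delta_mx a b) (delta_mx c d) = T a c d b.
Proof.
rewrite /second_kind (bigD1 a) //= [X in _ + X]big1 => [|i /negbTE ia]; last first.
  by do 3! [rewrite big1 // => ? _]; rewrite !mxE ia mulr0 mul0r.
rewrite addr0 (bigD1 c) //= [X in _ + X]big1 => [|i /negbTE ia]; last first.
  by do 2! [rewrite big1 // => ? _]; rewrite !mxE ia mulr0.
rewrite addr0 (bigD1 d) //= [X in _ + X]big1 => [|i /negbTE ia]; last first.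
  by rewrite big1 // => ? _; rewrite !mxE ia andbF mulr0.
rewrite addr0 (bigD1 b) //= big1 => [|i /negbTE ia]; last first.
  by rewrite !mxE ia andbF mulr0 mul0r.
by rewrite addr0 !mxE !eqxx !mulr1.
Qed.

Lemma second_kind_diag (d : 'rV[R]_n) :
  second_kind T (diag_mx d) (diag_mx d) = \sum_i \sum_j d 0 i * d 0 j * T i j j i.
Proof.
apply: eq_bigr => i _; apply: eq_bigr => j _.
rewrite (bigD1 j) //= [X in _ + X]big1 => [|k /negbTE kj]; last first.
  by rewrite big1 // => ? _; rewrite !mxE [j == k]eq_sym kj mulr0.
rewrite addr0 (bigD1 i) //= big1 => [|k /negbTE ki]; last first.
  by rewrite !mxE [i == k]eq_sym ki mulr0 mul0r.
by rewrite addr0 !mxE !eqxx !mulr1n; ring.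
Qed.

End SecondKindForm.

Lemma second_kind_scale (R : realType) (n : nat) (s : R)
    (T : 'I_n -> 'I_n -> 'I_n -> 'I_n -> R) A B :
  second_kind (fun a b c d => s * T a b c d) A B = s * second_kind T A B.
Proof.
rewrite /second_kind; do 4! [rewrite mulr_sumr; apply: eq_bigr => ? _ /=].
by ring.
Qed.

(** Exchanging the two indices matches the pairs above and below the diagonal. *)
Lemma sum_upper_pairs (R : realType) n (f : 'I_n -> 'I_n -> R) :
  (forall a b, f a b = f b a) -> (forall a, f a a = 0) ->
  \sum_(p : 'I_n * 'I_n | (p.1 < p.2)%N) f p.1 p.2 = 2^-1 * \sum_a \sum_b f a b.
Proof.
move=> fC f0; rewrite pair_bigA /=.
rewrite [in RHS](bigID (fun p : 'I_n * 'I_n => (p.1 < p.2)%N)) /=.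
have -> : \sum_(p : 'I_n * 'I_n | ~~ (p.1 < p.2)%N) f p.1 p.2 =
          \sum_(p : 'I_n * 'I_n | (p.1 < p.2)%N) f p.1 p.2.
  rewrite [RHS](reindex_inj (h := fun p : 'I_n * 'I_n => (p.2, p.1))) /=; last first.
    by move=> [a b] [c d] [-> ->].
  rewrite (bigID (fun p : 'I_n * 'I_n => (p.2 < p.1)%N)) /=.
  rewrite [X in _ + X]big1 ?addr0 => [|[a b] /=]; last first.
    by rewrite -!leqNgt -eqn_leq => /eqP/val_inj ->.
  apply: eq_big => [[a b]|[a b] _] /=; last exact: fC.
  by case: ltngtP.
by lra.
Qed.

(** * The algebraic core: a split curvature tensor has no sectional curvature *)

Section SplittingCurvature.
Variables (R : realType) (k l : nat) (alpha : R).
Variable T : 'I_(k + l) -> 'I_(k + l) -> 'I_(k + l) -> 'I_(k + l) -> R.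
Hypotheses (k0 : (0 < k)%N) (l0 : (0 < l)%N) (alpha_ge1 : 1 <= alpha).
Hypothesis alpha_le : alpha <= (dimS20 (k + l))%:R.
Hypothesis alpha_lt : alpha < (k * l)%:R + (2 * k * l)%:R / (k + l)%:R.
Hypothesis T_anti12 : forall a b c d, T a b c d = - T b a c d.
Hypothesis T_anti34 : forall a b c d, T a b c d = - T a b d c.
Hypothesis T_mixed : forall i j,
  T (lshift l i) (rshift k j) (lshift l i) (rshift k j) = 0.
Hypothesis sums_ge0 : forall phi : (dimS20 (k + l)).-tuple 'M[R]_(k + l),
  orthonormal_basis_S20 phi -> 0 <= alpha_sum alpha T phi.

Local Notation n := (k + l)%N.

Let kR : 0 < k%:R :> R. Proof. by rewrite ltr0n. Qed.
Let lR : 0 < l%:R :> R. Proof. by rewrite ltr0n. Qed.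

Definition sym_unit (a b : 'I_n) : 'M[R]_n :=
  (Num.sqrt 2)^-1 *: (delta_mx a b + delta_mx b a).

(** The eigenvalues of the tensor [l g1 - k g2], which is traceless because the two
    factors have dimensions [k] and [l]. *)
Definition balanced_row : 'rV[R]_n :=
  \row_a (if (a < k)%N then l%:R else - k%:R).

Definition balanced_unit : 'M[R]_n :=
  (Num.sqrt (k * l * n)%:R)^-1 *: diag_mx balanced_row.

(** The diagonal pair that indexes [balanced_unit] is [(o, o)], the only diagonal
    pair in [split_index]. *)
Definition split_family (p : 'I_n * 'I_n) : 'M[R]_n :=
  if p.1 == p.2 then balanced_unit else sym_unit p.1 p.2.

(** The weights inside the two factors are chosen so that the sectional curvatures
    contributed by the units [sym_unit a b] cancel against [balanced_unit]; the
    mixed units contribute nothing and can be given the largest weight, 1. *)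
Definition pair_weight (a b : 'I_n) : R :=
  if (a < k)%N then (if (b < k)%N then (2 * l)%:R / (k * n)%:R else 1)
  else (if (b < k)%N then 1 else (2 * k)%:R / (l * n)%:R).

Definition split_weight (p : 'I_n * 'I_n) : R :=
  if p.1 == p.2 then 1 else pair_weight p.1 p.2.

Let o : 'I_n := lshift l (Ordinal k0).

Definition split_index : pred ('I_n * 'I_n) :=
  fun p => (p.1 < p.2)%N || (p == (o, o)).

Lemma split_indexP p : split_index p -> p = (o, o) \/ (p.1 < p.2)%N && (p.1 != p.2).
Proof.
rewrite /split_index -val_eqE; case/orP => [p12|/eqP]; [right|by left].
by rewrite p12 neq_ltn p12.
Qed.

(** The pair [(o, o)] carries [balanced_unit], the others lie above the diagonal. *)
Lemma sum_split_index (f : 'I_n * 'I_n -> R) :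
  \sum_(p | split_index p) f p = f (o, o) + \sum_(p : 'I_n * 'I_n | (p.1 < p.2)%N) f p.
Proof.
rewrite (bigD1 (o, o)) /split_index ?eqxx ?orbT //=; congr (_ + _).
apply: eq_bigl => -[a b] /=; case: eqVneq => [[-> ->]|]; last by rewrite orbF andbT.
by rewrite andbF ltnn.
Qed.

Lemma sum_blocks (f : 'I_n -> 'I_n -> R) :
  \sum_a \sum_b f a b =
  \sum_(i < k) \sum_(j < k) f (lshift l i) (lshift l j)
  + \sum_(i < k) \sum_(j < l) f (lshift l i) (rshift k j)
  + (\sum_(i < l) \sum_(j < k) f (rshift k i) (lshift l j)
     + \sum_(i < l) \sum_(j < l) f (rshift k i) (rshift k j)).
Proof.
rewrite big_split_ord /= -!big_split /=.
by congr (_ + _); apply: eq_bigr => i _; rewrite big_split_ord.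
Qed.

Let lshift_lt (i : 'I_k) : (lshift l i < k)%N = true. Proof. by rewrite /= ltn_ord. Qed.
Let rshift_lt (j : 'I_l) : (rshift k j < k)%N = false.
Proof. by rewrite ltnNge /= leq_addr. Qed.

Lemma split_family_mem p : split_index p -> split_family p \in S20 R n.
Proof.
rewrite mem_S20 /split_family => /split_indexP[->|/andP[_ /negbTE p12]]; last first.
  rewrite p12 linearZ /= linearD /= !trmx_delta addrC eqxx linearZ /= linearD /=.
  rewrite /mxtrace !big1 => [|i _|i _]; rewrite ?addr0 ?mulr0 ?mxE //.
    by case: eqVneq => //= ->; rewrite eq_sym p12.
  by case: eqVneq => //= ->; rewrite p12.
rewrite eqxx linearZ /= tr_diag_mx eqxx /= linearZ /= mxtrace_diag big_split_ord /=.
under eq_bigr do rewrite mxE lshift_lt.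
under [X in _ + X]eq_bigr do rewrite mxE rshift_lt.
rewrite !sumr_const !card_ord -[_ *+ k]mulr_natl -[_ *+ l]mulr_natl.
by apply/eqP; ring.
Qed.

Lemma tensor_dotZ (a b : R) (A B : 'M[R]_n) :
  tensor_dot (a *: A) (b *: B) = a * b * tensor_dot A B.
Proof.
rewrite /tensor_dot; do 2! [rewrite mulr_sumr; apply: eq_bigr => ? _ /=].
by rewrite !mxE; ring.
Qed.

Lemma tensor_dot_delta a b (A : 'M[R]_n) : tensor_dot (delta_mx a b) A = A a b.
Proof.
rewrite /tensor_dot (bigD1 a) //= [X in _ + X]big1 => [|i /negbTE ia]; last first.
  by rewrite big1 // => ? _; rewrite !mxE ia mul0r.
rewrite addr0 (bigD1 b) //= big1 => [|i /negbTE ia]; last first.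
  by rewrite !mxE ia andbF mul0r.
by rewrite addr0 mxE !eqxx mul1r.
Qed.

Lemma tensor_dot_sym_unit a b (A : 'M[R]_n) :
  tensor_dot (sym_unit a b) A = (Num.sqrt 2)^-1 * (A a b + A b a).
Proof.
have := tensor_dotZ (Num.sqrt 2)^-1 1 (delta_mx a b + delta_mx b a) A.
rewrite scale1r mulr1 => ->; congr (_ * _).
have := tensor_dotDl 1 (delta_mx a b) (delta_mx b a) A.
by rewrite scale1r mul1r !tensor_dot_delta.
Qed.

Lemma sqrt2_inv2 : (Num.sqrt 2)^-1 ^+ 2 = 2^-1 :> R.
Proof. by rewrite exprVn sqr_sqrtr. Qed.

Lemma balanced_coef : (Num.sqrt (k * l * n)%:R)^-1 ^+ 2 = (k * l * n)%:R^-1 :> R.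
Proof. by rewrite exprVn sqr_sqrtr. Qed.

Lemma split_family_dot p q : split_index p -> split_index q ->
  tensor_dot (split_family p) (split_family q) = (p == q)%:R.
Proof.
have diag_off a b : a != b -> tensor_dot (sym_unit a b) balanced_unit = 0.
  move=> /negbTE ab; rewrite tensor_dot_sym_unit !mxE ab [b == a]eq_sym ab.
  by rewrite !mulr0n !mulr0 addr0 mulr0.
move=> /split_indexP[->|/andP[lt_p p12]] /split_indexP[->|/andP[lt_q q12]];
  rewrite /split_family ?eqxx ?(negbTE p12) ?(negbTE q12).
- rewrite tensor_dotZ -expr2 balanced_coef.
  have -> : tensor_dot (diag_mx balanced_row) (diag_mx balanced_row)
          = \sum_a balanced_row 0 a ^+ 2.
    apply: eq_bigr => a _; rewrite (bigD1 a) //= big1 => [|b /negbTE ba].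
      by rewrite !mxE eqxx !mulr1n addr0.
    by rewrite !mxE [a == b]eq_sym ba !mulr0n mulr0.
  rewrite big_split_ord /=.
  under eq_bigr do rewrite mxE lshift_lt.
  under [X in _ + X]eq_bigr do rewrite mxE rshift_lt.
  rewrite !sumr_const !card_ord -[_ *+ k]mulr_natl -[_ *+ l]mulr_natl.
  by rewrite !natrM natrD; field; rewrite !gt_eqF // addr_gt0.
- rewrite tensor_dotC diag_off //; suff -> : ((o, o) == q) = false by [].
  by apply: contraNF q12 => /eqP <-.
- rewrite diag_off //; suff -> : (p == (o, o)) = false by [].
  by apply: contraNF p12 => /eqP ->.
rewrite tensor_dot_sym_unit !mxE.
have -> : (p.1 == q.2) && (p.2 == q.1) = false.
  apply/andP => -[/eqP E1 /eqP E2]; move: lt_p lt_q; rewrite E1 E2 => /ltnW.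
  by rewrite leqNgt => /negbTE->.
rewrite [(p.2 == q.2) && _]andbC [(p.2 == q.1) && _]andbC.
have -> : (p.1 == q.2) && (p.2 == q.1) = false.
  apply/andP => -[/eqP E1 /eqP E2]; move: lt_p lt_q; rewrite E1 E2 => /ltnW.
  by rewrite leqNgt => /negbTE->.
rewrite addr0 add0r.
have -> : (p == q) = (p.1 == q.1) && (p.2 == q.2) by case: (p) (q) => ? ? [].
have := sqrt2_inv2; case: andb => /=; last by rewrite ?(mulr0, mul0r, addr0).
set s := _^-1; rewrite !mulr1 => E.
have -> : s * (s + s) = 2 * s ^+ 2 by ring.
by rewrite E mulfV.
Qed.

Local Notation K := (fun a b => T a b a b).

Let T_aacd a c d : T a a c d = 0.
Proof. by have := T_anti12 a a c d; lra. Qed.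
Let K_diag a : K a a = 0. Proof. exact: T_aacd. Qed.
Let K_sym a b : K a b = K b a.
Proof. by rewrite /= (T_anti12 a b) (T_anti34 b a a b) opprK. Qed.

Let S1 : R := \sum_(i < k) \sum_(j < k) K (lshift l i) (lshift l j).
Let S2 : R := \sum_(i < l) \sum_(j < l) K (rshift k i) (rshift k j).

(** The two products that involve a repeated index vanish by antisymmetry and the
    other two both give the sectional curvature. *)
Lemma second_kind_sym_unit a b : second_kind T (sym_unit a b) (sym_unit a b) = K a b.
Proof.
rewrite second_kindZ sqrt2_inv2 !second_kindDl !second_kindDr !second_kind_delta.
by rewrite !T_aacd [T b a b a]K_sym; lra.
Qed.

(** On a diagonal tensor the form is minus the sum of the sectional curvatures
    weighted by products of eigenvalues; only pairs inside one factor remain. *)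
Lemma second_kind_balanced_unit :
  second_kind T balanced_unit balanced_unit =
  - (l%:R ^+ 2 * S1 + k%:R ^+ 2 * S2) / (k * l * n)%:R.
Proof.
rewrite second_kindZ balanced_coef second_kind_diag mulrC; congr (_ / _).
rewrite (eq_bigr (fun i => \sum_j - (balanced_row 0 i * balanced_row 0 j * K i j))).
  rewrite sum_blocks /S1 /S2 [X in _ + X + _]big1 => [|i _]; last first.
    by rewrite big1 // => j _; rewrite T_mixed mulr0 oppr0.
  rewrite [X in _ + (X + _)]big1 => [|i _]; last first.
    by rewrite big1 // => j _; rewrite K_sym T_mixed mulr0 oppr0.
  rewrite addr0 add0r opprD -!mulrN -!sumrN !mulr_sumr.
  congr (_ + _); apply: eq_bigr => i _; rewrite -sumrN mulr_sumr; apply: eq_bigr => j _.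
    by rewrite !mxE !lshift_lt; ring.
  by rewrite !mxE !rshift_lt; ring.
by move=> i _; apply: eq_bigr => j _; rewrite T_anti34 mulrN.
Qed.

Let pair_weightC a b : pair_weight a b = pair_weight b a.
Proof. by rewrite /pair_weight; case: ifP; case: ifP. Qed.

Lemma sum_neq m (c : R) : \sum_(i < m) \sum_(j < m) c * (i != j)%:R = c * (m * m.-1)%:R.
Proof.
rewrite natrM mulrCA -[in RHS](card_ord m) mulr_natl -sumr_const.
apply: eq_bigr => i _; rewrite -mulr_sumr -natr_sum; congr (_ * _%:R).
rewrite card_ord -[in RHS](card_ord m) -(cardC1 i) -sum1_card [RHS]big_mkcond.
by apply: eq_bigr => j _; rewrite inE eq_sym; case: (j != i).
Qed.

(** The bound on alpha in the theorem is this total: [k l] mixed units, one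
    [balanced_unit], and [l (k - 1) / n + k (l - 1) / n] from inside the factors. *)
Lemma split_weight_total :
  \sum_(p | split_index p) split_weight p = (k * l)%:R + (2 * k * l)%:R / n%:R.
Proof.
rewrite sum_split_index /split_weight eqxx.
rewrite (eq_bigr (fun p => pair_weight p.1 p.2 * (p.1 != p.2)%:R)) => [|p]; last first.
  by rewrite ltn_neqAle val_eqE => /andP[/negbTE-> _]; rewrite mulr1.
rewrite (sum_upper_pairs (f := fun a b => pair_weight a b * (a != b)%:R)); last 2 first.
- by move=> a b; rewrite pair_weightC eq_sym.
- by move=> a; rewrite eqxx mulr0.
rewrite sum_blocks /pair_weight.
rewrite (eq_bigr (fun i => \sum_(j < k) (2 * l)%:R / (k * n)%:R * (i != j)%:R)); last first.
  by move=> i _; apply: eq_bigr => j _; rewrite !lshift_lt (inj_eq (@lshift_inj _ _)).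
rewrite [X in _ + _ + (_ + X)](eq_bigr
    (fun i => \sum_(j < l) (2 * k)%:R / (l * n)%:R * (i != j)%:R)); last first.
  by move=> i _; apply: eq_bigr => j _; rewrite !rshift_lt (inj_eq (@rshift_inj _ _)).
rewrite [X in _ + X + _](eq_bigr (fun i => \sum_(j < l) 1)); last first.
  by move=> i _; apply: eq_bigr => j _; rewrite lshift_lt rshift_lt eq_lrshift mulr1.
rewrite [X in _ + _ + (X + _)](eq_bigr (fun i => \sum_(j < k) 1)); last first.
  by move=> i _; apply: eq_bigr => j _; rewrite lshift_lt rshift_lt eq_rlshift mulr1.
rewrite !sum_neq; under [X in _ + X + _]eq_bigr do rewrite sumr_const card_ord.
under [X in _ + _ + (X + _)]eq_bigr do rewrite sumr_const card_ord.
rewrite !sumr_const !card_ord -!mulrnA.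
have pred_k : k.-1%:R = k%:R - 1 :> R by rewrite -subn1 natrB.
have pred_l : l.-1%:R = l%:R - 1 :> R by rewrite -subn1 natrB.
by rewrite !natrM natrD pred_k pred_l; field; rewrite !gt_eqF // addr_gt0.
Qed.

(** If [S1] and [S2] are the scalar curvatures of the factors and [n = k + l],
    [balanced_unit] contributes [- l S1 / (k n) - k S2 / (l n)], and so
    the units inside the factors have to contribute the opposite. *)
Lemma split_weight_balanced :
  \sum_(p | split_index p)
    split_weight p * second_kind T (split_family p) (split_family p) = 0.
Proof.
rewrite sum_split_index /split_weight /split_family eqxx mul1r.
rewrite second_kind_balanced_unit.
rewrite (eq_bigr (fun p => pair_weight p.1 p.2 * K p.1 p.2)) => [|p]; last first.
  by rewrite ltn_neqAle val_eqE => /andP[/negbTE-> _]; rewrite second_kind_sym_unit.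
rewrite (sum_upper_pairs (f := fun a b => pair_weight a b * K a b)); last 2 first.
- by move=> a b; rewrite pair_weightC K_sym.
- by move=> a; rewrite K_diag mulr0.
rewrite sum_blocks [X in _ + X + _]big1 => [|i _]; last first.
  by rewrite big1 // => j _; rewrite T_mixed mulr0.
rewrite [X in _ + (X + _)]big1 => [|i _]; last first.
  by rewrite big1 // => j _; rewrite K_sym T_mixed mulr0.
rewrite addr0 add0r.
have -> : \sum_(i < k) \sum_(j < k) pair_weight (lshift l i) (lshift l j) * K (lshift l i) (lshift l j)
        = (2 * l)%:R / (k * n)%:R * S1.
  rewrite /S1; do 2! [rewrite mulr_sumr; apply: eq_bigr => ? _ /=].
  by rewrite /pair_weight !lshift_lt.
have -> : \sum_(i < l) \sum_(j < l) pair_weight (rshift k i) (rshift k j) * K (rshift k i) (rshift k j)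
        = (2 * k)%:R / (l * n)%:R * S2.
  rewrite /S2; do 2! [rewrite mulr_sumr; apply: eq_bigr => ? _ /=].
  by rewrite /pair_weight !rshift_lt.
by rewrite !natrM natrD; field; rewrite !gt_eqF // addr_gt0.
Qed.

(** A factor contains a pair of distinct indices only if its dimension is at least
    two, and then its weight is at most one. *)
Lemma split_weight_bounds p : split_index p -> 0 < split_weight p <= 1.
Proof.
have n0 : 0 < n%:R :> R by rewrite ltr0n addn_gt0 k0.
rewrite /split_weight => /split_indexP[->|/andP[p_lt /negbTE->]].
  by rewrite eqxx ltr01 lexx.
rewrite /pair_weight; case: ifP => p1k; case: ifP => p2k; rewrite ?ltr01 ?lexx //.
  have k2 : (2 <= k)%N by apply: leq_ltn_trans p2k; apply: leq_ltn_trans p_lt.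
  rewrite divr_gt0 ?ltr0n ?muln_gt0 ?k0 ?l0 ?addn_gt0 ?k0 //=.
  rewrite ler_pdivrMr ?ltr0n ?muln_gt0 ?k0 ?addn_gt0 ?k0 // mul1r ler_nat.
  by rewrite leq_mul // leq_addl.
have l2 : (2 <= l)%N.
  have : (k <= p.1)%N by rewrite leqNgt p1k.
  move=> kp; have := ltn_ord p.2; rewrite -(ltn_add2l 0) => p2n.
  have : (k.+1 < k + l)%N by apply: leq_ltn_trans (ltn_ord p.2); apply: leq_ltn_trans p_lt.
  by rewrite -addn1 ltn_add2l.
rewrite divr_gt0 ?ltr0n ?muln_gt0 ?k0 ?l0 ?addn_gt0 ?k0 //=.
rewrite ler_pdivrMr ?ltr0n ?muln_gt0 ?l0 ?addn_gt0 ?k0 // mul1r ler_nat.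
by rewrite leq_mul // leq_addr.
Qed.

(** The weighted sum is zero while the total weight exceeds alpha, so there is room
    to lower a single weight; the sum must stay nonnegative. *)
Lemma split_family_le0 p : split_index p ->
  second_kind T (split_family p) (split_family p) <= 0.
Proof.
move=> Pp; set r := fun A : 'M[R]_n => second_kind T A A.
have /andP[wp0 wp1] := split_weight_bounds Pp.
(* The decrease keeps the weight nonnegative and the total at least alpha. *)
pose e := Num.min (split_weight p) ((k * l)%:R + (2 * k * l)%:R / n%:R - alpha).
have e0 : 0 < e by rewrite lt_min wp0 subr_gt0 alpha_lt.
pose w q := split_weight q - e * (q == p)%:R.
have sum_delta (f : 'I_n * 'I_n -> R) :
    \sum_(q | split_index q) e * (q == p)%:R * f q = e * f p.
  rewrite (bigD1 p) //= eqxx mulr1 big1 ?addr0 // => q /andP[_ /negbTE->].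
  by rewrite mulr0 mul0r.
have : 0 <= \sum_(q | split_index q) w q * r (split_family q).
  apply: (family_weighted_sum_ge0 _ alpha_ge1 alpha_le sums_ge0) => //.
  - by rewrite addn_gt0 k0.
  - exact: split_family_mem.
  - exact: split_family_dot.
  - move=> q /split_weight_bounds/andP[wq0 wq1]; rewrite /w; case: eqP => [->|_] /=.
      by rewrite mulr1 subr_ge0 ge_min lexx /=; lra.
    by rewrite mulr0 subr0 ltW.
  rewrite /w sumrB split_weight_total.
  have := sum_delta (fun=> 1); under eq_bigr do rewrite mulr1; rewrite mulr1 => ->.
  by rewrite lerBrDr -lerBrDl ge_min lexx orbT.
rewrite /w; under eq_bigr do rewrite mulrBl.
by rewrite sumrB split_weight_balanced sum_delta sub0r oppr_ge0 pmulr_rle0.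
Qed.

(** The weighted sum is a sum of nonpositive terms that vanishes, so each of its
    terms vanishes. *)
Lemma split_sectional_eq0 a b : T a b a b = 0.
Proof.
have H (c d : 'I_n) : (c < d)%N -> T c d c d = 0.
  move=> cd; have Pcd : split_index (c, d) by rewrite /split_index /= cd.
  have cd' : c == d = false by rewrite -val_eqE ltn_eqF.
  have F0 : forall p, split_index p ->
      0 <= - (split_weight p * second_kind T (split_family p) (split_family p)).
    move=> p Pp; have /andP[wp0 _] := split_weight_bounds Pp.
    by rewrite oppr_ge0 pmulr_rle0 // split_family_le0.
  have /eqP := split_weight_balanced; rewrite -oppr_eq0 -sumrN psumr_eq0 //.
  move=> /allP/(_ (c, d) (mem_index_enum _)); rewrite Pcd /= oppr_eq0 mulf_eq0.
  have /andP[wp0 _] := split_weight_bounds Pcd.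
  by rewrite (gt_eqF wp0) /= /split_family /= cd' second_kind_sym_unit => /eqP.
have [/H //|/H ba|/val_inj ->] := ltngtP a b; first by rewrite K_sym.
exact: K_diag.
Qed.

End SplittingCurvature.

(** * Frames, and recovering a curvature tensor from its sectional curvatures *)

Definition gram_form (R : realType) n (g : 'M[R]_n) (x y : 'rV[R]_n) : R :=
  (x *m g *m y^T) 0 0.

Lemma gram_form_rows (R : realType) n m (g : 'M[R]_n) (E : 'M[R]_(m, n)) i j :
  gram_form g (row i E) (row j E) = (E *m g *m E^T) i j.
Proof. by rewrite /gram_form -row_mul !mxE; apply: eq_bigr => r _; rewrite !mxE. Qed.

Section Frames.
Variables (R : realType) (n : nat) (g : 'M[R]_n).
Hypotheses (g_sym : g^T = g).
Hypothesis g_pos : forall v : 'rV[R]_n, v != 0 -> 0 < (v *m g *m v^T) 0 0.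

Lemma gram_formDl a u v w :
  gram_form g (a *: u + v) w = a * gram_form g u w + gram_form g v w.
Proof. by rewrite /gram_form !mulmxDl -!scalemxAl !mxE. Qed.

Lemma gram_formC u v : gram_form g u v = gram_form g v u.
Proof.
rewrite /gram_form; have -> : u *m g *m v^T = (v *m g *m u^T)^T.
  by rewrite !trmx_mul trmxK g_sym mulmxA.
by rewrite mxE.
Qed.

Lemma posdef_unitmx : g \in unitmx.
Proof.
rewrite -row_free_unit; apply/inj_row_free => v vg; apply/eqP/contraT => /g_pos.
by rewrite vg mul0mx mxE ltxx.
Qed.

Lemma frame_complete (X : seq 'rV[R]_n) : orthonormal (gram_form g) X ->
  exists2 E : 'M[R]_n, E *m g *m E^T = 1%:M & forall x, x \in X -> exists a, row a E = x.
Proof.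
move=> oX.
have [|||||Y [XY oY bY]] :=
  @orthonormal_complete R 'rV[R]_n (gram_form g) _ _ _ fullv X.
- exact: gram_formDl.
- exact: gram_formC.
- exact: g_pos.
- by move=> x _; rewrite memvf.
- exact: oX.
have szY : size Y = n.
  by rewrite -(size_basis (X := in_tuple Y) bY) dimvf /dim /= mul1n.
exists (\matrix_(i < n) Y`_i).
  apply/matrixP => i j; rewrite -gram_form_rows !rowK oY.2 ?mem_nth ?szY //.
  by rewrite nth_uniq ?szY ?oY.1 // mxE.
move=> x /XY xY; have ix : (index x Y < n)%N.
  by rewrite -[X in (_ < X)%N]szY index_mem.
by exists (Ordinal ix); rewrite rowK /= nth_index.
Qed.

End Frames.

Section Quadrilinear.
Variables (R : realType) (n : nat).
Implicit Types (T : 'I_n -> 'I_n -> 'I_n -> 'I_n -> R) (x y z w : 'rV[R]_n).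

(** The multilinear form whose components are [T].  On rows of a frame it is
    [riemann_in_frame]. *)
Definition tensor4 T x y z w : R :=
  \sum_p \sum_q \sum_r \sum_s x 0 p * y 0 q * z 0 r * w 0 s * T p q r s.

Lemma tensor4_1 T a x x' y z w :
  tensor4 T (a *: x + x') y z w = a * tensor4 T x y z w + tensor4 T x' y z w.
Proof.
rewrite /tensor4; do 4! [rewrite mulr_sumr -big_split; apply: eq_bigr => ? _ /=].
by rewrite !mxE; ring.
Qed.

Lemma tensor4_2 T a x y y' z w :
  tensor4 T x (a *: y + y') z w = a * tensor4 T x y z w + tensor4 T x y' z w.
Proof.
rewrite /tensor4; do 4! [rewrite mulr_sumr -big_split; apply: eq_bigr => ? _ /=].
by rewrite !mxE; ring.
Qed.

Lemma tensor4_3 T a x y z z' w :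
  tensor4 T x y (a *: z + z') w = a * tensor4 T x y z w + tensor4 T x y z' w.
Proof.
rewrite /tensor4; do 4! [rewrite mulr_sumr -big_split; apply: eq_bigr => ? _ /=].
by rewrite !mxE; ring.
Qed.

Lemma tensor4_4 T a x y z w w' :
  tensor4 T x y z (a *: w + w') = a * tensor4 T x y z w + tensor4 T x y z w'.
Proof.
rewrite /tensor4; do 4! [rewrite mulr_sumr -big_split; apply: eq_bigr => ? _ /=].
by rewrite !mxE; ring.
Qed.

Lemma tensor4_delta T a b c d :
  tensor4 T (delta_mx 0 a) (delta_mx 0 b) (delta_mx 0 c) (delta_mx 0 d) = T a b c d.
Proof.
rewrite /tensor4 (bigD1 a) //= [X in _ + X]big1 => [|i /negbTE ia]; last first.
  by do 3! [rewrite big1 // => ? _]; rewrite !mxE ia andbF !mul0r.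
rewrite addr0 (bigD1 b) //= [X in _ + X]big1 => [|i /negbTE ia]; last first.
  by do 2! [rewrite big1 // => ? _]; rewrite !mxE ia andbF mulr0 !mul0r.
rewrite addr0 (bigD1 c) //= [X in _ + X]big1 => [|i /negbTE ia]; last first.
  by rewrite big1 // => ? _; rewrite !mxE ia andbF mulr0 !mul0r.
rewrite addr0 (bigD1 d) //= big1 => [|i /negbTE ia]; last first.
  by rewrite !mxE ia andbF mulr0 mul0r.
by rewrite addr0 !mxE !eqxx !mul1r.
Qed.

Lemma tensor4_anti12 T : (forall a b c d, T a b c d = - T b a c d) ->
  forall x y z w, tensor4 T x y z w = - tensor4 T y x z w.
Proof.
move=> T12 x y z w; rewrite /tensor4 exchange_big /=.
do 4! [rewrite -sumrN; apply: eq_bigr => ? _ /=].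
by rewrite T12; ring.
Qed.

Lemma tensor4_anti34 T : (forall a b c d, T a b c d = - T a b d c) ->
  forall x y z w, tensor4 T x y z w = - tensor4 T x y w z.
Proof.
move=> T34 x y z w; rewrite /tensor4.
do 2! [rewrite -sumrN; apply: eq_bigr => ? _ /=]; rewrite exchange_big /=.
do 2! [rewrite -sumrN; apply: eq_bigr => ? _ /=].
by rewrite T34; ring.
Qed.

Section Polarization.
Variable T : 'I_n -> 'I_n -> 'I_n -> 'I_n -> R.
Hypothesis T_anti12 : forall a b c d, T a b c d = - T b a c d.
Hypothesis T_anti34 : forall a b c d, T a b c d = - T a b d c.
Hypothesis T_bianchi : forall a b c d, T a b c d + T b c a d + T c a b d = 0.

(** The octahedron argument: the sum of the four Bianchi identities that omit one
    index from the last position reduces by antisymmetry to the claim. *)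
Lemma curvature_pair_sym a b c d : T a b c d = T c d a b.
Proof.
have B1 := T_bianchi b c a d; have B2 := T_bianchi c a d b.
have B3 := T_bianchi a d b c; have B4 := T_bianchi d b c a.
have E1 := T_anti34 b c a d; have E2 := T_anti34 c a b d.
have E3 := T_anti12 b a d c; have E4 := T_anti34 a b d c.
have E5 := T_anti34 a d c b; have E6 := T_anti12 d c a b.
have E7 := T_anti34 c d a b; have E8 := T_anti34 d b a c.
lra.
Qed.

(** Polarization: expanding the hypothesis at sums of two basis vectors in both
    slots makes [T] antisymmetric in its second and fourth index, hence in all
    four, and then the Bianchi identity reads [3 T = 0]. *)
Lemma sectional_zero_curvature_zero :
  (forall x y, tensor4 T x y x y = 0) -> forall a b c d, T a b c d = 0.
Proof.
move=> Q0; pose e (a : 'I_n) : 'rV[R]_n := delta_mx 0 a.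
have Qe1 a b : T a b a b = 0 by rewrite -tensor4_delta Q0.
have Qe2 a b c : T a b c b = 0.
  have := Q0 (1 *: e a + e c) (e b).
  rewrite !(tensor4_1, tensor4_3) !tensor4_delta !Qe1 (curvature_pair_sym c b a b).
  by lra.
have Qe3 a b c : T a b a c = 0.
  have := Q0 (e a) (1 *: e b + e c).
  rewrite !(tensor4_2, tensor4_4) !tensor4_delta !Qe1 (curvature_pair_sym a c a b).
  by lra.
have Qe4 a b c d : T a b c d = - T a d c b.
  have := Q0 (1 *: e a + e c) (1 *: e b + e d).
  rewrite !(tensor4_1, tensor4_2, tensor4_3, tensor4_4) !tensor4_delta.
  rewrite !Qe2 !Qe3 (curvature_pair_sym c d a b) (curvature_pair_sym c b a d).
  by lra.
move=> a b c d; have B := T_bianchi a b c d.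
have E1 := Qe4 b c a d; have E2 := T_anti34 b d a c; have E3 := Qe4 b d c a.
have E4 := T_anti12 b a c d; have E5 := T_anti12 c a b d.
have E6 := Qe4 a c b d; have E7 := T_anti34 a d b c; have E8 := Qe4 a d c b.
lra.
Qed.

(** Antisymmetry allows the Gram-Schmidt process on the pair [x], [y] without
    changing the value beyond a scalar factor. *)
Lemma tensor4_sectional_eq0 (g : 'M[R]_n) :
  g^T = g -> (forall v : 'rV[R]_n, v != 0 -> 0 < (v *m g *m v^T) 0 0) ->
  (forall x y, gram_form g x x = 1 -> gram_form g y y = 1 -> gram_form g x y = 0 ->
     tensor4 T x y x y = 0) ->
  forall x y, tensor4 T x y x y = 0.
Proof.
move=> g_sym g_pos Q1.
have gZ c x y : gram_form g (c *: x) y = c * gram_form g x y.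
  by rewrite -[c *: x]addr0 gram_formDl {2}/gram_form !mul0mx !mxE addr0.
have Q0l y : tensor4 T 0 y 0 y = 0.
  by have := tensor4_1 T 1 0 0 y 0 y; rewrite scale1r addr0; lra.
have QZ c d x y : tensor4 T (c *: x) (d *: y) (c *: x) (d *: y)
    = (c * d) ^+ 2 * tensor4 T x y x y.
  rewrite /tensor4; do 4! [rewrite mulr_sumr; apply: eq_bigr => ? _ /=].
  by rewrite !mxE; ring.
have normalize x : x != 0 -> exists2 c, c != 0 & gram_form g (c *: x) (c *: x) = 1.
  move=> x0; have gx := g_pos x x0; exists (Num.sqrt (gram_form g x x))^-1.
    by rewrite invr_eq0 gt_eqF // sqrtr_gt0.
  rewrite gZ gram_formC // gZ mulrA -expr2 exprVn sqr_sqrtr ?ltW //.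
  by rewrite mulVf // gt_eqF.
have Q2 x y : gram_form g x y = 0 -> tensor4 T x y x y = 0.
  move=> xy; have [->|/normalize[c c0 cx]] := eqVneq x 0; first exact: Q0l.
  have [->|/normalize[d d0 dy]] := eqVneq y 0.
    by rewrite tensor4_anti12 // tensor4_anti34 // opprK Q0l.
  have := QZ c d x y; rewrite Q1 //; last first.
    by rewrite gZ gram_formC // gZ gram_formC // xy !mulr0.
  by move/esym/eqP; rewrite mulf_eq0 sqrf_eq0 mulf_eq0 (negbTE c0) (negbTE d0) => /eqP.
move=> x y; have [->|x0] := eqVneq x 0; first exact: Q0l.
(* t x + y is the component of y orthogonal to x. *)
pose t := - (gram_form g x y / gram_form g x x).
have xx0 z w : tensor4 T x x z w = 0 by have := tensor4_anti12 T_anti12 x x z w; lra.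
have xx0' z w : tensor4 T z w x x = 0 by have := tensor4_anti34 T_anti34 z w x x; lra.
have := Q2 x (t *: x + y); rewrite !(tensor4_2, tensor4_4) !xx0 xx0'.
rewrite !(mulr0, add0r); apply.
rewrite gram_formC // gram_formDl /t mulNr divfK ?gt_eqF ?g_pos //.
by rewrite [gram_form g y x]gram_formC // addNr.
Qed.

End Polarization.
End Quadrilinear.

(** * Symmetry of second derivatives *)

Section Calculus.
Variable R : realType.

(** The difference of the two functions vanishes near [x], so it has derivative
    zero there. *)
Lemma near_eq_differentiable (V W : normedModType R) (f g : V -> W) (x : V) :
  (\near x, f x = g x) -> differentiable f x -> differentiable g x.
Proof.
move=> fg df.
have fg0 : \forall y \near (0 : V), f (y + x) = g (y + x).
  by move: fg; rewrite (near_shift 0) subr0.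
have e0 : (g - f) \o shift x = cst ((g - f) x) + (0 : V -> W) +o_ 0 id.
  apply/eqaddoP => _/posnumP[e]; near=> y.
  have fgx : f x = g x by exact: nbhs_singleton fg.
  have fgy : f (y + x) = g (y + x) by near: y.
  rewrite addr0 !fctE /= fgx fgy !subrr normr0.
  by rewrite mulr_ge0.
have d0 : 'd (g - f) x = (0 : V -> W) :> (V -> W).
  by apply: diff_unique e0; exact: cst_continuous.
have de : differentiable (g - f) x.
  by apply/diff_locallyP; rewrite d0; split => //; exact: cst_continuous.
have -> : g = f + (g - f) by rewrite addrC subrK.
exact: differentiableD.
Unshelve. all: by end_near. Qed.

Lemma derivable_line (V W : normedModType R) (f : V -> W) (y u : V) (s : R) :
  derivable f (y + s *: u) u ->
  is_derive s 1 (fun s => f (y + s *: u)) ('D_u f (y + s *: u)).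
Proof.
have E : (fun h => h^-1 *: (((fun s => f (y + s *: u)) \o shift s) (h *: 1) - f (y + s *: u)))
     = (fun h : R => h^-1 *: ((f \o shift (y + s *: u)) (h *: u) - f (y + s *: u))).
  rewrite funeqE => h /=; congr (_ *: (f _ - _)).
  by rewrite scalerDl [h *: 1]mulr1 addrCA.
move=> df; apply: DeriveDef; first by rewrite /derivable E.
by rewrite /derive E.
Qed.

(** The mean value theorem along the segment from [y] to [y + h u]. *)
Lemma directional_mvt (V : normedModType R) (f : V -> R) (y u : V) (h : R) :
  0 < h -> (forall s, 0 <= s <= h -> derivable f (y + s *: u) u) ->
  exists2 s, 0 < s < h & f (y + h *: u) - f y = h * 'D_u f (y + s *: u).
Proof.
move=> h0 df.
pose F s := f (y + s *: u); pose dF s := 'D_u f (y + s *: u).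
have dFP s : 0 <= s <= h -> is_derive s 1 F (dF s).
  by move=> /df; apply: derivable_line.
have [||s s_in E] := @MVT R F dF 0 h h0.
- by move=> s; rewrite in_itv /= => /andP[s0 sh]; apply: dFP; rewrite !ltW.
- apply: continuous_in_subspaceT => s; rewrite inE /= in_itv /= => s_in.
  have [dFs _] := dFP s s_in.
  exact/differentiable_continuous/derivable1_diffP.
exists s; first by move: s_in; rewrite in_itv.
by move: E; rewrite /F /dF scale0r addr0 subr0 mulrC.
Qed.

(** The second difference is the increment along [u] of the increments of [f]
    along [v]; the mean value theorem is applied once in each direction. *)
Lemma second_difference (V : normedModType R) (f : V -> R) (x u v : V) (h : R) :
  0 < h ->
  (forall s t, 0 <= s <= h -> 0 <= t <= h ->
     derivable f (x + s *: u + t *: v) u /\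
     derivable ('D_u f) (x + s *: u + t *: v) v) ->
  exists s t, [/\ 0 <= s <= h, 0 <= t <= h &
    f (x + h *: u + h *: v) - f (x + h *: u) - f (x + h *: v) + f x =
    h * (h * 'D_v ('D_u f) (x + s *: u + t *: v))].
Proof.
move=> h0 df.
have h0h : 0 <= h <= h by rewrite ltW // lexx.
have h00 : 0 <= (0 : R) <= h by rewrite lexx ltW.
pose G y := f (y + h *: v) - f y.
have dG s : 0 <= s <= h -> is_derive (x + s *: u) u G
    ('D_u f (x + s *: u + h *: v) - 'D_u f (x + s *: u)).
  move=> s_in; have [d1 _] := df s h s_in h0h; have [d2 _] := df s 0 s_in h00.
  rewrite scale0r addr0 in d2.
  have d3 : is_derive (x + s *: u) u (fun y => f (y + h *: v)) ('D_u f (x + s *: u + h *: v)).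
    (* The difference quotients of a translate are those of f at the translated point. *)
    have E : (fun k : R => k^-1 *: (((fun y => f (y + h *: v)) \o shift (x + s *: u)) (k *: u)
                - f (x + s *: u + h *: v)))
       = (fun k : R => k^-1 *: ((f \o shift (x + s *: u + h *: v)) (k *: u)
                - f (x + s *: u + h *: v))).
      by rewrite funeqE => k /=; rewrite !addrA.
    apply: DeriveDef; first by rewrite /derivable E.
    by rewrite /derive E.
  exact: is_deriveB.
have [s] := @directional_mvt V G x u h h0 (fun s s_in => @ex_derive _ _ _ _ _ _ _ (dG s s_in)).
move=> /andP[s0 sh]; have s_in : 0 <= s <= h by rewrite !ltW.
rewrite (@derive_val _ _ _ _ _ _ _ (dG s s_in)) => E1.
have [|t /andP[t0 th] E2] := @directional_mvt V ('D_u f) (x + s *: u) v h h0.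
  by move=> t t_in; have [] := df s t s_in t_in.
exists s, t; split; rewrite ?ltW //.
by rewrite -E2 -E1 /G; ring.
Qed.

(** The second difference is symmetric in [u] and [v], so by [second_difference]
    the two iterated derivatives take a common value at points arbitrarily close
    to [x], and both are continuous there. *)
Theorem schwarz (V : normedModType R) (A : set V) (f : V -> R) (x u v : V) :
  open A -> smooth_on A f -> A x -> 'D_u ('D_v f) x = 'D_v ('D_u f) x.
Proof.
move=> oA sf Ax; apply/eqP; rewrite -subr_eq0 -normr_eq0; apply/eqP/le_anti.
rewrite normr_ge0 andbT; apply/ler_addgt0Pl => e e0; rewrite addr0.
have tri (p q w : R) : `|p - w| < e / 2 -> `|q - w| < e / 2 -> `|q - p| <= e.
  move=> pw qw; have -> : q - p = (q - w) - (p - w) by ring.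
  by apply: le_trans (ler_normB _ _) _; lra.
pose a := 'D_v ('D_u f); pose b := 'D_u ('D_v f).
have ca : {for x, continuous a} by apply: differentiable_continuous (sf [:: v; u] x Ax).
have cb : {for x, continuous b} by apply: differentiable_continuous (sf [:: u; v] x Ax).
have e2 : 0 < e / 2 by rewrite divr_gt0.
have [r r0 rP] : exists2 r, 0 < r & forall y, ball x r y ->
    [/\ A y, `|a x - a y| < e / 2 & `|b x - b y| < e / 2].
  have nA : nbhs x A by exact: open_nbhs_nbhs.
  have na : \forall y \near x, `|a x - a y| < e / 2 by exact: (cvgrPdist_lt _ _).1 ca _ e2.
  have nb : \forall y \near x, `|b x - b y| < e / 2 by exact: (cvgrPdist_lt _ _).1 cb _ e2.
  have /nbhs_ballP[r1 /= r10 H1] := nA.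
  have /nbhs_ballP[r2 /= r20 H2] := na.
  have /nbhs_ballP[r3 /= r30 H3] := nb.
  exists (Num.min r1 (Num.min r2 r3)) => [|y Hy]; first by rewrite !lt_min r10 r20.
  split.
  - by apply: H1; apply: le_ball Hy; rewrite ge_min lexx.
  - by apply: H2; apply: le_ball Hy; rewrite !ge_min lexx orbT.
  - by apply: H3; apply: le_ball Hy; rewrite !ge_min lexx !orbT.
(* This step keeps the whole parallelogram spanned by h u and h v in the ball. *)
pose h := r / 2 / (1 + `|u| + `|v|).
have N0 : 0 < 1 + `|u| + `|v| by rewrite !ltr_wpDr.
have h0 : 0 < h by rewrite !divr_gt0.
have in_ball s t : 0 <= s <= h -> 0 <= t <= h -> ball x r (x + s *: u + t *: v).
  move=> /andP[s0 sh] /andP[t0 th].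
  rewrite -ball_normE /= -addrA opprD addrA subrr add0r normrN.
  apply: le_lt_trans (ler_normD _ _) _; rewrite !normrZ !ger0_norm //.
  have : h * (1 + `|u| + `|v|) = r / 2 by rewrite /h divfK // gt_eqF.
  have : s * `|u| <= h * `|u| by rewrite ler_wpM2r.
  have : t * `|v| <= h * `|v| by rewrite ler_wpM2r.
  by nra.
have df1 s t : 0 <= s <= h -> 0 <= t <= h ->
    derivable f (x + s *: u + t *: v) u /\ derivable ('D_u f) (x + s *: u + t *: v) v.
  move=> s_in t_in; have [Ay _ _] := rP _ (in_ball s t s_in t_in).
  by split; apply: diff_derivable; [exact: (sf [::] _ Ay)|exact: (sf [:: u] _ Ay)].
have [s [t [s_in t_in E1]]] := second_difference h0 df1.
have df2 t2 s2 : 0 <= t2 <= h -> 0 <= s2 <= h ->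
    derivable f (x + t2 *: v + s2 *: u) v /\
    derivable ('D_v f) (x + t2 *: v + s2 *: u) u.
  move=> t2_in s2_in; have [Ay _ _] := rP _ (in_ball s2 t2 s2_in t2_in).
  rewrite addrAC in Ay.
  by split; apply: diff_derivable; [exact: (sf [::] _ Ay)|exact: (sf [:: v] _ Ay)].
have [t' [s' [t'_in s'_in E2]]] := second_difference h0 df2.
rewrite (addrAC x (h *: v)) -/b in E2; rewrite -/a in E1.
have ab : a (x + s *: u + t *: v) = b (x + t' *: v + s' *: u).
  have hn : h != 0 by rewrite gt_eqF.
  apply: (mulfI hn); apply: (mulfI hn); apply: etrans (esym E1) _.
  by apply: etrans _ E2; congr (_ + _); exact: addrAC.
have [_ ax _] := rP _ (in_ball s t s_in t_in).
have [_ _ bx] := rP _ (in_ball s' t' s'_in t'_in); rewrite addrAC in bx.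
by rewrite -ab in bx; exact (tri _ _ _ ax bx).
Qed.

End Calculus.

(** * Entrywise calculus for matrix-valued functions *)

Section MatrixCalculus.
Variable R : realType.

Section DifferentiableOperations.
Variables (V : normedModType R) (x : V).
Implicit Types f g : V -> R.

Lemma differentiable_fun_sum (I : Type) (r : seq I) (F : I -> V -> R) :
  (forall i, differentiable (F i) x) ->
  differentiable (fun y => \sum_(i <- r) F i y) x.
Proof.
move=> dF; elim: r => [|i r IH].
  have -> : (fun y => \sum_(i <- [::]) F i y) = cst 0 by rewrite funeqE => y; rewrite big_nil.
  exact: differentiable_cst.
have -> : (fun y => \sum_(j <- i :: r) F j y) = F i + (fun y => \sum_(i <- r) F i y).
  by rewrite funeqE => y; rewrite big_cons.
exact: differentiableD.
Qed.

Lemma differentiable_fun_prod (I : Type) (r : seq I) (F : I -> V -> R) :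
  (forall i, differentiable (F i) x) ->
  differentiable (fun y => \prod_(i <- r) F i y) x.
Proof.
move=> dF; elim: r => [|i r IH].
  have -> : (fun y => \prod_(i <- [::]) F i y) = cst 1 by rewrite funeqE => y; rewrite big_nil.
  exact: differentiable_cst.
have -> : (fun y => \prod_(j <- i :: r) F j y) = F i * (fun y => \prod_(i <- r) F i y).
  by rewrite funeqE => y; rewrite big_cons.
exact: differentiableM.
Qed.

Lemma derive_fun_sum (I : Type) (r : seq I) (F : I -> V -> R) v :
  (forall i, differentiable (F i) x) ->
  'D_v (fun y => \sum_(i <- r) F i y) x = \sum_(i <- r) 'D_v (F i) x.
Proof.
move=> dF; elim: r => [|i r IH].
  have -> : (fun y => \sum_(i <- [::]) F i y) = cst 0 by rewrite funeqE => y; rewrite big_nil.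
  by rewrite derive_cst big_nil.
have -> : (fun y => \sum_(j <- i :: r) F j y) = F i + (fun y => \sum_(i <- r) F i y).
  by rewrite funeqE => y; rewrite big_cons.
rewrite deriveD ?IH ?big_cons //; apply: diff_derivable => //.
exact: differentiable_fun_sum.
Qed.

Lemma derive_fun_mul f g v : differentiable f x -> differentiable g x ->
  'D_v (fun y => f y * g y) x = 'D_v f x * g x + f x * 'D_v g x.
Proof.
move=> df dg; have -> : (fun y => f y * g y) = f * g by [].
by rewrite deriveM; try exact: diff_derivable; rewrite addrC [X in X + _]mulrC.
Qed.

End DifferentiableOperations.

Section MatrixFunctions.
Variables (V : normedModType R) (x : V).

(** Differentiability and derivatives are taken entry by entry, since the
    Christoffel symbols and the curvature are defined from partial derivatives of
    scalar functions. *)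
Definition mx_diff p q (A : V -> 'M[R]_(p, q)) (x : V) : Prop :=
  forall i j, differentiable (fun y => A y i j) x.

Definition dmx p q (v : V) (A : V -> 'M[R]_(p, q)) (x : V) : 'M[R]_(p, q) :=
  \matrix_(i, j) 'D_v (fun y => A y i j) x.

Lemma dmxE p q v (A : V -> 'M[R]_(p, q)) i j : dmx v A x i j = 'D_v (fun y => A y i j) x.
Proof. by rewrite mxE. Qed.

Lemma mx_diff_near p q (A B : V -> 'M[R]_(p, q)) :
  (\near x, A x = B x) -> mx_diff A x -> mx_diff B x.
Proof.
move=> AB dA i j; apply: near_eq_differentiable (dA i j).
by near=> y; rewrite (near AB y).
Unshelve. all: by end_near. Qed.

Lemma dmx_near p q v (A B : V -> 'M[R]_(p, q)) :
  (\near x, A x = B x) -> dmx v A x = dmx v B x.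
Proof.
move=> AB; apply/matrixP => i j; rewrite !mxE; apply: near_eq_derive.
by near=> y; rewrite (near AB y).
Unshelve. all: by end_near. Qed.

Lemma mx_diffM p q r (A : V -> 'M[R]_(p, q)) (B : V -> 'M[R]_(q, r)) :
  mx_diff A x -> mx_diff B x -> mx_diff (fun y => A y *m B y) x.
Proof.
move=> dA dB i j.
have -> : (fun y => (A y *m B y) i j) = (fun y => \sum_k A y i k * B y k j).
  by rewrite funeqE => y; rewrite mxE.
by apply: differentiable_fun_sum => k; apply: differentiableM.
Qed.

Lemma dmxM p q r v (A : V -> 'M[R]_(p, q)) (B : V -> 'M[R]_(q, r)) :
  mx_diff A x -> mx_diff B x ->
  dmx v (fun y => A y *m B y) x = dmx v A x *m B x + A x *m dmx v B x.
Proof.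
move=> dA dB; apply/matrixP => i j; rewrite !mxE.
have -> : (fun y => (A y *m B y) i j) = (fun y => \sum_k A y i k * B y k j).
  by rewrite funeqE => y; rewrite mxE.
rewrite derive_fun_sum => [|k]; last exact: differentiableM.
by rewrite -big_split; apply: eq_bigr => k _ /=; rewrite !mxE derive_fun_mul.
Qed.

Lemma dmxD p q v (A B : V -> 'M[R]_(p, q)) :
  mx_diff A x -> mx_diff B x ->
  dmx v (fun y => A y + B y) x = dmx v A x + dmx v B x.
Proof.
move=> dA dB; apply/matrixP => i j; rewrite !mxE.
have -> : (fun y => (A y + B y) i j) = (fun y => A y i j) + (fun y => B y i j).
  by rewrite funeqE => y; rewrite mxE.
by rewrite deriveD //; apply: diff_derivable.
Qed.

Lemma mx_diff_tr p q (A : V -> 'M[R]_(p, q)) :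
  mx_diff A x -> mx_diff (fun y => (A y)^T) x.
Proof.
move=> dA i j; have -> : (fun y => (A y)^T i j) = (fun y => A y j i) => //.
by rewrite funeqE => y; rewrite mxE.
Qed.

Lemma dmx_tr p q v (A : V -> 'M[R]_(p, q)) :
  dmx v (fun y => (A y)^T) x = (dmx v A x)^T.
Proof.
apply/matrixP => i j; rewrite !mxE.
by have -> : (fun y => (A y)^T i j) = (fun y => A y j i) by rewrite funeqE => y; rewrite mxE.
Qed.

Lemma differentiable_det n (A : V -> 'M[R]_n) :
  mx_diff A x -> differentiable (fun y => \det (A y)) x.
Proof.
move=> dA; apply: differentiable_fun_sum => s.
apply: differentiableM; first exact: differentiable_cst.
by apply: differentiable_fun_prod => i.
Qed.

(** Near [x] the inverse is given by Cramer's rule, whose entries are rational in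
    the entries of the matrix. *)
Lemma mx_diff_invmx n (A : V -> 'M[R]_n) :
  (\near x, A x \in unitmx) -> mx_diff A x -> mx_diff (fun y => invmx (A y)) x.
Proof.
move=> uA dA.
apply: (@mx_diff_near _ _ (fun y => (\det (A y))^-1 *: \adj (A y))).
  by near=> y; rewrite /invmx (near uA y).
move=> i j.
have -> : (fun y => ((\det (A y))^-1 *: \adj (A y)) i j) =
   (fun y => (\det (A y))^-1) * (fun y => cofactor (A y) j i).
  by rewrite funeqE => y; rewrite !mxE.
apply: differentiableM.
  apply: differentiableV; first exact: differentiable_det.
  by have := nbhs_singleton uA; rewrite unitmxE unitfE.
apply: differentiableM; first exact: differentiable_cst.
apply: differentiable_det => a b.
have -> : (fun y => row' j (col' i (A y)) a b) = (fun y => A y (lift j a) (lift i b)).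
  by rewrite funeqE => y; rewrite !mxE.
exact: dA.
Unshelve. all: by end_near. Qed.

(** Taking an entry commutes with iterated directional derivatives only on [A],
    where the derivatives exist; openness of [A] lets one differentiate this
    equality again. *)
Lemma smooth_entry p q (A : set V) (F : V -> 'M[R]_(p, q)) i j :
  open A -> smooth_on A F -> smooth_on A (fun y => F y i j).
Proof.
move=> oA sF.
have entry_diff s y : A y -> differentiable (fun z => foldr (fun v g => 'D_v g) F s z i j) y.
  move=> Ay; apply: (@differentiable_comp _ _ _ _ _ (fun M : 'M[R]_(p, q) => M i j)) (sF s y Ay) _.
  exact: differentiable_coord.
have E s y : A y -> foldr (fun v g => 'D_v g) (fun y => F y i j) s y =
                    foldr (fun v g => 'D_v g) F s y i j.
  elim: s y => // v s IH y Ay /=.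
  rewrite derive_mx; last by apply: diff_derivable; apply: sF.
  rewrite mxE; apply: near_eq_derive; near=> z; apply: IH; near: z.
  exact: open_nbhs_nbhs.
move=> s y Ay; apply: near_eq_differentiable (entry_diff s y Ay).
near=> z; apply/esym/E; near: z; exact: open_nbhs_nbhs.
Unshelve. all: by end_near. Qed.

Lemma smooth_derive (W : normedModType R) (A : set V) (f : V -> W) v :
  smooth_on A f -> smooth_on A ('D_v f).
Proof. by move=> sf s y Ay; have := sf (rcons s v) y Ay; rewrite foldr_rcons. Qed.

End MatrixFunctions.

Lemma derive_chain n m (F : 'rV[R]_n -> 'rV[R]_m) (f : 'rV[R]_m -> R) (x v : 'rV[R]_n) :
  differentiable F x -> differentiable f (F x) ->
  'D_v (fun y => f (F y)) x = \sum_p ('D_v F x) 0 p * partial p f (F x).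
Proof.
move=> dF df; rewrite deriveE; last exact: differentiable_comp.
rewrite (diff_comp dF df) /= -(deriveE v dF); set w := 'D_v F x.
rewrite [in LHS](row_sum_delta w) linear_sum /=.
by apply: eq_bigr => p _; rewrite linearZ /= /partial deriveE.
Qed.

Lemma jacobian_entry n m (F : 'rV[R]_n -> 'rV[R]_m) x a p :
  differentiable F x -> jacobian F x a p = partial a (fun y => F y 0 p) x.
Proof.
move=> dF; have := deriveEjacobian (delta_mx 0 a) dF; rewrite -rowE.
rewrite derive_mx; last exact: diff_derivable.
by move=> /rowP/(_ p); rewrite !mxE.
Qed.

End MatrixCalculus.

(** * The Levi-Civita connection and the symmetries of its curvature *)

(** The cancellation behind the skew-symmetry of the curvature of a metric
    connection: the mixed term [Q h P^T] enters only as a matrix minus its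
    transpose, which adding the transpose removes. *)
Lemma commutator_skew (R : realType) (n : nat) (P Q X Y h : 'M[R]_n) : h^T = h ->
  (X *m h + Q *m (P *m h + h *m P^T)) + (X *m h + Q *m (P *m h + h *m P^T))^T
  - ((Y *m h + P *m (Q *m h + h *m Q^T)) + (Y *m h + P *m (Q *m h + h *m Q^T))^T)
  = (X - Y + (Q *m P - P *m Q)) *m h + ((X - Y + (Q *m P - P *m Q)) *m h)^T.
Proof.
move=> hT; set M1 := _ + Q *m _; set M2 := _ + P *m _; set O := _ *m h.
pose W := Q *m h *m P^T.
have WT : P *m h *m Q^T = W^T by rewrite /W !trmx_mul trmxK hT mulmxA.
have E : M1 - M2 = O + (W - W^T).
  rewrite -WT /W /M1 /M2 /O !(mulmxDl, mulNmx) !mulmxDr !mulmxA.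
  move: (X *m h) (Y *m h) (Q *m P *m h) (P *m Q *m h) (Q *m h *m _) (P *m h *m _).
  by move=> a b c d e f; apply/matrixP => i j; rewrite !mxE; ring.
have -> : M1 + M1^T - (M2 + M2^T) = (M1 - M2) + (M1 - M2)^T.
  by rewrite linearB /= opprD addrACA.
by rewrite E linearD linearB /= trmxK addrACA subrKA subrr addr0.
Qed.

Section LeviCivita.
Variables (R : realType) (n : nat).
Implicit Types (g : 'rV[R]_n -> 'M[R]_n) (A : set 'rV[R]_n) (x : 'rV[R]_n).

Definition coord_dir (a : 'I_n) : 'rV[R]_n := delta_mx 0 a.

(** A Riemannian metric in coordinates on an open set, with smoothness by entries so
    that it is inherited by block matrices. *)
Record metric_on A g : Prop := MetricOn {
  metric_on_open : open A ;
  metric_on_smooth : forall i j, smooth_on A (fun y => g y i j) ;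
  metric_on_sym : forall x, A x -> (g x)^T = g x ;
  metric_on_posdef : forall x (v : 'rV[R]_n), A x -> v != 0 ->
    0 < (v *m g x *m v^T) 0 0 }.

(** Row [b] of [connection g a x] holds the components of the covariant derivative
    of the [b]-th coordinate field along the [a]-th one. *)
Definition connection g (a : 'I_n) (x : 'rV[R]_n) : 'M[R]_n :=
  \matrix_(b, c) christoffel g a b c x.

(** The curvature endomorphism of the [a]-th and [b]-th coordinate fields, acting on
    row vectors from the right; this explains the order of the products. *)
Definition curvature_form g (a b : 'I_n) (x : 'rV[R]_n) : 'M[R]_n :=
  dmx (coord_dir a) (connection g b) x - dmx (coord_dir b) (connection g a) x
  + (connection g b x *m connection g a x - connection g a x *m connection g b x).

(** The Koszul argument: with [L a b d] the components of the lowered symbols, the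
    combination of derivatives in [christoffel] is [2 L a b d]. *)
Lemma connection_unique g x (G : 'I_n -> 'M[R]_n) :
  (g x)^T = g x -> g x \in unitmx ->
  (forall a, dmx (coord_dir a) g x = G a *m g x + g x *m (G a)^T) ->
  (forall a b c, G a b c = G b a c) ->
  forall a, connection g a x = G a.
Proof.
move=> gT gU Gg Gsym a; apply/matrixP => b c; rewrite mxE /christoffel.
(* The connection coefficients with the upper index lowered. *)
pose L a := G a *m g x.
have dg a' b' d : partial a' (fun y => g y b' d) x = L a' b' d + L a' d b'.
  have /matrixP/(_ b' d) := Gg a'; rewrite mxE => E; apply: etrans E _.
  rewrite mxE; congr (_ + _).
  by rewrite -[g x in LHS]gT -trmx_mul mxE.
have Lsym a' b' d : L a' b' d = L b' a' d.
  by rewrite !mxE; apply: eq_bigr => e _; rewrite Gsym.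
have invT : (invmx (g x))^T = invmx (g x) by rewrite trmx_inv gT.
transitivity ((L a *m invmx (g x)) b c); last by rewrite mulmxK.
rewrite [RHS]mxE mulr_sumr; apply: eq_bigr => d _.
rewrite -{1}invT [_^T c d]mxE !dg (Lsym b a) (Lsym d b) (Lsym d a).
by field.
Qed.

Section OnOpen.
Variables (A : set 'rV[R]_n) (g : 'rV[R]_n -> 'M[R]_n).
Hypothesis gA : metric_on A g.

Lemma near_open x : A x -> \forall y \near x, A y.
Proof. by move=> Ax; apply: open_nbhs_nbhs; split => //; exact: metric_on_open gA. Qed.

Lemma metric_on_unitmx x : A x -> g x \in unitmx.
Proof. by move=> Ax; apply: posdef_unitmx => v; exact: (metric_on_posdef gA). Qed.

Lemma metric_on_diff x : A x -> mx_diff g x.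
Proof. by move=> Ax i j; exact (metric_on_smooth gA i j [::] Ax). Qed.

Lemma metric_on_partial_sym x a b c : A x ->
  partial a (fun y => g y b c) x = partial a (fun y => g y c b) x.
Proof.
move=> Ax; apply: near_eq_derive; near=> y.
by rewrite -[in LHS](metric_on_sym gA (x := y)) ?mxE //; near: y; exact: near_open.
Unshelve. all: by end_near. Qed.

Lemma christoffel_sym x a b c : A x -> christoffel g a b c x = christoffel g b a c x.
Proof.
move=> Ax; rewrite /christoffel; congr (_ * _); apply: eq_bigr => d _; congr (_ * _).
by rewrite (metric_on_partial_sym d a b Ax); ring.
Qed.

Lemma connection_metric x a : A x ->
  dmx (coord_dir a) g x = connection g a x *m g x + g x *m (connection g a x)^T.
Proof.
move=> Ax.
(* The Christoffel symbols of the first kind in direction a. *)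
pose S b d := 2^-1 * (partial a (fun y => g y b d) x + partial b (fun y => g y a d) x
     - partial d (fun y => g y a b) x).
have LS b d : (connection g a x *m g x) b d = S b d.
  pose Sm : 'M[R]_n := \matrix_(b, d) S b d.
  suff -> : connection g a x = Sm *m invmx (g x).
    by rewrite mulmxKV ?metric_on_unitmx // mxE.
  apply/matrixP => b' c; rewrite !mxE /christoffel mulr_sumr; apply: eq_bigr => e _.
  have invT : (invmx (g x))^T = invmx (g x) by rewrite trmx_inv (metric_on_sym gA Ax).
  by rewrite -{1}invT !mxE /S; ring.
have -> : g x *m (connection g a x)^T = (connection g a x *m g x)^T.
  by rewrite trmx_mul (metric_on_sym gA Ax).
apply/matrixP => b d; rewrite [RHS]mxE LS [_^T b d]mxE LS mxE /S.
rewrite (metric_on_partial_sym a d b Ax) -/(partial a (fun y => g y b d) x).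
by field.
Qed.

(** The inverse matrix in the Christoffel symbols is the only nonlinear
    ingredient. *)
Lemma connection_diff x a : A x -> mx_diff (connection g a) x.
Proof.
move=> Ax b c.
have dp e i j : differentiable (fun y => partial e (fun z => g z i j) y) x.
  exact (metric_on_smooth gA i j [:: coord_dir e] Ax).
have di : mx_diff (fun y => invmx (g y)) x.
  apply: mx_diff_invmx (metric_on_diff Ax); near=> y; apply: metric_on_unitmx.
  by near: y; exact: near_open.
have -> : (fun y => connection g a y b c) = (fun y => 2^-1 * \sum_(d < n) invmx (g y) c d *
    (partial a (fun y => g y b d) y + partial b (fun y => g y a d) y
     - partial d (fun y => g y a b) y)).
  by rewrite funeqE => y; rewrite mxE.
apply: differentiableM; first exact: differentiable_cst.
apply: differentiable_fun_sum => d; apply: differentiableM; first exact: di.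
by apply: differentiableB => //; apply: differentiableD.
Unshelve. all: by end_near. Qed.

Lemma metric_second_derivatives_sym x a b : A x ->
  dmx (coord_dir a) (dmx (coord_dir b) g) x = dmx (coord_dir b) (dmx (coord_dir a) g) x.
Proof.
move=> Ax; apply/matrixP => i j; rewrite [LHS]dmxE [RHS]dmxE.
have E v : (fun y => dmx v g y i j) = 'D_v (fun y => g y i j).
  by rewrite funeqE => y; rewrite dmxE.
rewrite (E (coord_dir b)) (E (coord_dir a)).
exact: (schwarz _ _ (metric_on_open gA) (metric_on_smooth gA i j) Ax).
Qed.

Lemma curvature_mixedE x a b c d : curvature_mixed g a b c d x = curvature_form g a b x c d.
Proof.
have E e : (fun y => connection g e y c d) = christoffel g e c d.
  by rewrite funeqE => y; rewrite mxE.
have dE e e' : dmx (coord_dir e) (connection g e') x c d = partial e (christoffel g e' c d) x.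
  by rewrite dmxE E.
have ent (P Q U W : 'M[R]_n) : (P - Q + (U - W)) c d = P c d - Q c d + (U c d - W c d).
  by rewrite !mxE.
rewrite /curvature_mixed /curvature_form ent; congr (_ + _).
  by congr (_ - _); [exact: esym (dE a b)|exact: esym (dE b a)].
by rewrite sumrB; congr (_ - _); rewrite [RHS]mxE; apply: eq_bigr => e _; rewrite !mxE.
Qed.

Lemma riemann_tensorE x a b c d : A x ->
  riemann_tensor g a b c d x = (curvature_form g a b x *m g x) d c.
Proof.
move=> Ax; rewrite mxE; apply: eq_bigr => e _; rewrite curvature_mixedE mulrC.
by congr (_ * _); rewrite -{1}(metric_on_sym gA Ax) mxE.
Qed.

Lemma curvature_form_anti x a b : curvature_form g b a x = - curvature_form g a b x.
Proof. by rewrite /curvature_form opprD !opprB. Qed.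

Lemma riemann_anti12 x a b c d : A x ->
  riemann_tensor g a b c d x = - riemann_tensor g b a c d x.
Proof.
by move=> Ax; rewrite !riemann_tensorE // [in RHS]curvature_form_anti mulNmx [in RHS]mxE opprK.
Qed.

(** Differentiate the metric condition a second time; the left-hand side is then
    symmetric in the two directions. *)
Lemma curvature_form_skew x a b : A x ->
  curvature_form g a b x *m g x + (curvature_form g a b x *m g x)^T = 0.
Proof.
move=> Ax; have gT := metric_on_sym gA Ax.
have second a' b' : dmx (coord_dir a') (dmx (coord_dir b') g) x =
    (dmx (coord_dir a') (connection g b') x *m g x
     + connection g b' x *m (connection g a' x *m g x + g x *m (connection g a' x)^T))
    + (dmx (coord_dir a') (connection g b') x *m g x
     + connection g b' x *m (connection g a' x *m g x + g x *m (connection g a' x)^T))^T.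
  have nE : \forall y \near x, dmx (coord_dir b') g y =
      connection g b' y *m g y + (connection g b' y *m g y)^T.
    near=> y; have Ay : A y by near: y; exact: near_open.
    by rewrite connection_metric // trmx_mul (metric_on_sym gA Ay).
  have dL : mx_diff (fun y => connection g b' y *m g y) x.
    by apply: mx_diffM; [exact: connection_diff|exact: metric_on_diff].
  rewrite (dmx_near _ nE) dmxD //; last exact: mx_diff_tr.
  rewrite dmx_tr dmxM; [|exact: connection_diff|exact: metric_on_diff].
  by rewrite (connection_metric a' Ax).
have := metric_second_derivatives_sym a b Ax; rewrite !second => /eqP.
rewrite -subr_eq0 => /eqP <-; rewrite /curvature_form.
exact: esym (commutator_skew _ _ _ _ gT).
Unshelve. all: by end_near. Qed.

Lemma riemann_anti34 x a b c d : A x ->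
  riemann_tensor g a b c d x = - riemann_tensor g a b d c x.
Proof.
move=> Ax; rewrite !riemann_tensorE //; apply/eqP; rewrite -addr_eq0; apply/eqP.
by have /matrixP/(_ d c) := curvature_form_skew a b Ax; rewrite !mxE.
Qed.

(** Because the connection is symmetric, the derivatives of the symbols cancel
    cyclically, and so do their products. *)
Lemma curvature_mixed_bianchi x a b c d : A x ->
  curvature_mixed g a b c d x + curvature_mixed g b c a d x + curvature_mixed g c a b d x = 0.
Proof.
move=> Ax.
pose p e i j := partial e (christoffel g i j d) x.
pose q i j e := \sum_(f < n) christoffel g i j f x * christoffel g e f d x.
have E i j e : curvature_mixed g i j e d x = p i j e - p j i e + (q j e i - q i e j).
  by rewrite /curvature_mixed sumrB.
have pC e i j : p e i j = p e j i.
  apply: near_eq_derive; near=> y; apply: christoffel_sym; near: y; exact: near_open.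
have qC i j e : q i j e = q j i e.
  by apply: eq_bigr => f _; rewrite (christoffel_sym i j f Ax).
clearbody p q; rewrite !E (pC a c b) (pC b c a) (pC c b a) (qC c b a) (qC b a c) (qC a c b); ring.
Unshelve. all: by end_near. Qed.

Lemma riemann_bianchi x a b c d : A x ->
  riemann_tensor g a b c d x + riemann_tensor g b c a d x + riemann_tensor g c a b d x = 0.
Proof.
move=> Ax; rewrite (riemann_anti34 a b c d Ax) (riemann_anti34 b c a d Ax).
rewrite (riemann_anti34 c a b d Ax) /riemann_tensor -!opprD -!big_split /= big1 ?oppr0 // => e _.
by rewrite -!mulrDr curvature_mixed_bianchi // mulr0.
Qed.

End OnOpen.
End LeviCivita.

(** * Change of coordinates *)

(** The algebra behind the tensoriality of curvature: if [J] relates two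
    connections as a change of gauge and the derived relations hold, with the same
    second derivative [ddJ] in both orders, then [J] relates the curvatures. *)
Lemma gauge_curvature (R : realType) (n : nat)
    (Ga Gb J dJa dJb Ba Bb dGab dGba ddJ dBab dBba : 'M[R]_n) :
  Ga *m J = dJa + J *m Ba -> Gb *m J = dJb + J *m Bb ->
  dGab *m J + Gb *m dJa = ddJ + (dJa *m Bb + J *m dBab) ->
  dGba *m J + Ga *m dJb = ddJ + (dJb *m Ba + J *m dBba) ->
  (dGab - dGba + (Gb *m Ga - Ga *m Gb)) *m J
  = J *m (dBab - dBba + (Bb *m Ba - Ba *m Bb)).
Proof.
move=> ga gb dab dba.
have {}dab : dGab *m J = ddJ + (dJa *m Bb + J *m dBab) - Gb *m dJa by rewrite -dab addrK.
have {}dba : dGba *m J = ddJ + (dJb *m Ba + J *m dBba) - Ga *m dJb by rewrite -dba addrK.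
rewrite !(mulmxDl, mulNmx, mulmxDr, mulmxN) dab dba -!mulmxA ga gb !mulmxDr.
rewrite [Ga *m (J *m Bb)]mulmxA [Gb *m (J *m Ba)]mulmxA ga gb !mulmxDl -!mulmxA.
move: (J *m (Ba *m Bb)) (J *m (Bb *m Ba)) (dJa *m Bb) (dJb *m Ba).
move: (J *m dBab) (J *m dBba) (Ga *m dJb) (Gb *m dJa).
by move=> e f c d o p q r; apply/matrixP => i j; rewrite !mxE; ring.
Qed.

Lemma mx_diff_comp (R : realType) (n m p q : nat) (F : 'rV[R]_n -> 'rV[R]_m)
    (f : 'rV[R]_m -> 'M[R]_(p, q)) x :
  differentiable F x -> mx_diff f (F x) -> mx_diff (fun y => f (F y)) x.
Proof.
move=> dF df i j; exact: (@differentiable_comp _ _ _ _ F (fun z => f z i j) x dF (df i j)).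
Qed.

Lemma dmx_comp (R : realType) (n m p q : nat) (F : 'rV[R]_n -> 'rV[R]_m)
    (f : 'rV[R]_m -> 'M[R]_(p, q)) x a :
  differentiable F x -> mx_diff f (F x) ->
  dmx (coord_dir R a) (fun y => f (F y)) x
  = \sum_r jacobian F x a r *: dmx (coord_dir R r) f (F x).
Proof.
move=> dF df; apply/matrixP => i j; rewrite dmxE (derive_chain _ dF (df i j)) summxE.
apply: eq_bigr => r _; rewrite [RHS]mxE dmxE; congr (_ * _).
by rewrite (deriveEjacobian _ dF) -rowE mxE.
Qed.

Section Transformation.
Variables (R : realType) (n : nat) (A B : set 'rV[R]_n).
Variables (g h : 'rV[R]_n -> 'M[R]_n) (F : 'rV[R]_n -> 'rV[R]_n).
Hypotheses (gA : metric_on A g) (hB : metric_on B h).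
Hypothesis F_smooth : smooth_on A F.
Hypothesis F_in : forall x, A x -> B (F x).
Hypothesis g_pullback : forall x, A x -> g x = pullback_metric F h x.

Local Notation J := (jacobian F).

Let F_diff x : A x -> differentiable F x.
Proof. by move=> Ax; exact: (F_smooth [::] Ax). Qed.

Let F_entry p : smooth_on A (fun y => F y 0 p).
Proof. exact: smooth_entry (metric_on_open gA) F_smooth. Qed.

Let J_entry x a p : A x -> J x a p = 'D_(coord_dir R a) (fun y => F y 0 p) x.
Proof. by move=> Ax; apply: jacobian_entry; exact: F_diff. Qed.

Let J_unit x : A x -> J x \in unitmx.
Proof.
move=> Ax; have := metric_on_unitmx gA Ax.
by rewrite g_pullback // /pullback_metric !unitmx_mul => /andP[/andP[]].
Qed.

Let J_near x a p : A x ->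
  \forall y \near x, 'D_(coord_dir R a) (fun y => F y 0 p) y = J y a p.
Proof.
move=> Ax; near=> y; apply: esym; apply: J_entry; near: y; exact: (near_open gA).
Unshelve. all: by end_near. Qed.

Let J_diff x : A x -> mx_diff J x.
Proof.
move=> Ax a p; apply: near_eq_differentiable (J_near a p Ax) _.
exact (F_entry p [:: coord_dir R a] Ax).
Qed.

Let dJ x v b p : A x ->
  dmx v J x b p = 'D_v ('D_(coord_dir R b) (fun y => F y 0 p)) x.
Proof. by move=> Ax; rewrite dmxE; apply/esym/near_eq_derive; exact: J_near. Qed.

Let dJ_sym x a b p : A x ->
  dmx (coord_dir R a) J x b p = dmx (coord_dir R b) J x a p.
Proof.
move=> Ax; apply: etrans (dJ _ _ _ Ax) _; apply: etrans _ (esym (dJ _ _ _ Ax)).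
exact: (schwarz _ _ (metric_on_open gA) (F_entry p) Ax).
Qed.

Let dJ_near x v b p : A x ->
  \forall y \near x, dmx v J y b p = 'D_v ('D_(coord_dir R b) (fun y => F y 0 p)) y.
Proof.
move=> Ax; near=> y; apply: dJ; near: y; exact: (near_open gA).
Unshelve. all: by end_near. Qed.

Let dJ_diff x v : A x -> mx_diff (dmx v J) x.
Proof.
move=> Ax b p; apply: near_eq_differentiable (_ : \near x, _ x = _ x) _; last first.
  exact (F_entry p [:: v; coord_dir R b] Ax).
near=> y; apply: esym; near: y; exact: dJ_near.
Unshelve. all: by end_near. Qed.

Let ddJ_sym x u v : A x -> dmx u (dmx v J) x = dmx v (dmx u J) x.
Proof.
move=> Ax; apply/matrixP => b p; rewrite [LHS]dmxE [RHS]dmxE.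
apply: etrans (near_eq_derive _ (dJ_near v b p Ax)) _.
apply: etrans _ (esym (near_eq_derive _ (dJ_near u b p Ax))).
have sD : smooth_on A ('D_(coord_dir R b) (fun y => F y 0 p)) := smooth_derive _ (F_entry p).
exact: (schwarz _ _ (metric_on_open gA) sD Ax).
Qed.

(** The pull-back of the connection of [h] along [F], in the frame of the target. *)
Definition pulled_connection (a : 'I_n) (y : 'rV[R]_n) : 'M[R]_n :=
  \sum_p J y a p *: connection h p (F y).

(** The transformation law of Christoffel symbols.  The right-hand side times the
    inverse of [J] is symmetric and compatible with [g], so it is the Levi-Civita
    connection of [g]. *)
Lemma connection_pullback x a : A x ->
  connection g a x *m J x = dmx (coord_dir R a) J x + J x *m pulled_connection a x.
Proof.
move=> Ax; have Bx := F_in Ax; have hT := metric_on_sym hB Bx.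
(* The right-hand side of the law; M times the inverse Jacobian is the candidate connection. *)
pose M a := dmx (coord_dir R a) J x + J x *m pulled_connection a x.
suff -> : connection g a x = M a *m invmx (J x) by rewrite mulmxKV // J_unit.
have M_sym a' b r : M a' b r = M b a' r.
  have ME c d e : M c d e = dmx (coord_dir R c) J x d e + (J x *m pulled_connection c x) d e.
    by rewrite mxE.
  apply: etrans (ME _ _ _) _; apply: etrans _ (esym (ME _ _ _)).
  congr (_ + _); first exact: dJ_sym.
  have E c d : (J x *m pulled_connection c x) d r
      = \sum_p \sum_s J x c p * J x d s * christoffel h p s r (F x).
    rewrite mxE exchange_big /=; apply: eq_bigr => s _.
    rewrite summxE mulr_sumr; apply: eq_bigr => p _.
    rewrite [X in _ * X]mxE [X in _ * (_ * X)]mxE mulrA; congr (_ * _); exact: mulrC.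
  rewrite !E exchange_big; apply: eq_bigr => p _; apply: eq_bigr => s _ /=.
  by rewrite (christoffel_sym hB s p r Bx); ring.
apply: (connection_unique (G := fun a' => M a' *m invmx (J x))
  (metric_on_sym gA Ax) (metric_on_unitmx gA Ax)); last first.
  by move=> a' b c; rewrite mxE [RHS]mxE; apply: eq_bigr => r _; rewrite M_sym.
move=> a'.
have nE : \forall y \near x, g y = J y *m (h (F y) *m (J y)^T).
  near=> y; rewrite mulmxA; apply: g_pullback; near: y; exact: (near_open gA).
have dhF : mx_diff (fun y => h (F y)) x.
  by apply: mx_diff_comp; [exact: F_diff|exact: (metric_on_diff hB Bx)].
have dJT : mx_diff (fun y => (J y)^T) x by apply: mx_diff_tr; exact: J_diff.
rewrite (dmx_near _ nE) dmxM //; [|exact: J_diff|exact: mx_diffM].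
rewrite dmxM // dmx_tr dmx_comp //; [|exact: F_diff|exact: (metric_on_diff hB Bx)].
have -> : \sum_r J x a' r *: dmx (coord_dir R r) h (F x)
    = pulled_connection a' x *m h (F x) + h (F x) *m (pulled_connection a' x)^T.
  rewrite /pulled_connection mulmx_suml linear_sum /= mulmx_sumr -big_split.
  apply: eq_bigr => r _ /=; rewrite (connection_metric hB r Bx) scalerDr.
  by rewrite linearZ /= -scalemxAl -scalemxAr.
rewrite (g_pullback Ax) /pullback_metric /M.
have JU := J_unit Ax.
move: (dmx _ _ x) (pulled_connection a' x) (J x) JU (h (F x)) hT => D P K KU H HT.
have EL : (D + K *m P) *m invmx K *m (K *m H *m K^T) = (D + K *m P) *m H *m K^T.
  by rewrite !mulmxA mulmxKV.
have ER : K *m H *m K^T *m ((D + K *m P) *m invmx K)^T = K *m H *m (D + K *m P)^T.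
  by rewrite trmx_mul -!mulmxA; congr (_ *m (_ *m _));
     rewrite mulmxA -trmx_mul mulVmx // trmx1 mul1mx.
rewrite EL ER !(mulmxDl, mulmxDr, linearD) /= !trmx_mul !mulmxA.
move: (D *m H *m _) (K *m P *m H *m _) (K *m H *m _ *m _) (K *m H *m _) => u v w z.
by apply/matrixP => i j; rewrite !mxE; ring.
Unshelve. all: by end_near. Qed.

(** The first sum involves the second derivatives of [F]; it is symmetric in [a] and
    [b] and cancels in the curvature. *)
Lemma dmx_pulled_connection x a b : A x ->
  mx_diff (pulled_connection b) x /\
  dmx (coord_dir R a) (pulled_connection b) x =
  \sum_p dmx (coord_dir R a) J x b p *: connection h p (F x)
  + \sum_p \sum_q (J x a p * J x b q) *: dmx (coord_dir R p) (connection h q) (F x).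
Proof.
move=> Ax; have Bx := F_in Ax.
have dC p : mx_diff (connection h p) (F x) by exact: (connection_diff hB _ Bx).
have dCF p : mx_diff (fun y => connection h p (F y)) x.
  by apply: mx_diff_comp; [exact: F_diff|exact: dC].
have E i j : (fun y => pulled_connection b y i j)
    = (fun y => \sum_p J y b p * connection h p (F y) i j).
  by rewrite funeqE => y; rewrite summxE; apply: eq_bigr => p _; rewrite mxE.
have dterm i j p : differentiable (fun y => J y b p * connection h p (F y) i j) x.
  by apply: differentiableM; [exact: J_diff|exact: dCF].
split=> [i j|]; first by rewrite E; exact: differentiable_fun_sum.
apply/matrixP => i j; rewrite dmxE E derive_fun_sum // mxE exchange_big /= !summxE -big_split.
apply: eq_bigr => q _ /=; rewrite derive_fun_mul; [|exact: J_diff|exact: dCF].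
rewrite [X in _ = X + _]mxE dmxE; congr (_ + _).
have := dmx_comp a (F_diff Ax) (dC q) => /matrixP/(_ i j); rewrite dmxE => ->.
rewrite !summxE mulr_sumr; apply: eq_bigr => p _.
by rewrite [X in _ * X]mxE [RHS]mxE mulrA [J x b q * _]mulrC.
Qed.

(** [gauge_curvature] applies to the transformation law and its derivatives, whose
    second derivatives of [J] agree by [schwarz]. *)
Lemma curvature_form_pullback x a b : A x ->
  curvature_form g a b x *m J x
  = J x *m \sum_p \sum_q (J x a p * J x b q) *: curvature_form h p q (F x).
Proof.
move=> Ax.
have step u v : dmx (coord_dir R u) (connection g v) x *m J x
      + connection g v x *m dmx (coord_dir R u) J x
    = dmx (coord_dir R u) (dmx (coord_dir R v) J) x
      + (dmx (coord_dir R u) J x *m pulled_connection v x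
         + J x *m dmx (coord_dir R u) (pulled_connection v) x).
  have [dP _] := dmx_pulled_connection u v Ax.
  rewrite -dmxM; [|exact: (connection_diff gA _ Ax)|exact: J_diff].
  rewrite -dmxM; [|exact: J_diff|exact: dP].
  rewrite -dmxD; [|exact: dJ_diff|by apply: mx_diffM; [exact: J_diff|exact: dP]].
  apply: dmx_near; near=> y; apply: connection_pullback; near: y; exact: (near_open gA).
have := step b a; rewrite ddJ_sym // => step_ba.
apply: etrans (gauge_curvature (connection_pullback a Ax) (connection_pullback b Ax)
  (step a b) step_ba) _; congr (_ *m _).
rewrite (dmx_pulled_connection a b Ax).2 (dmx_pulled_connection b a Ax).2.
have -> : \sum_p dmx (coord_dir R b) J x a p *: connection h p (F x)
        = \sum_p dmx (coord_dir R a) J x b p *: connection h p (F x).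
  by apply: eq_bigr => p _; congr (_ *: _); exact: dJ_sym.
have -> : \sum_p \sum_q (J x b p * J x a q) *: dmx (coord_dir R p) (connection h q) (F x)
    = \sum_p \sum_q (J x a p * J x b q) *: dmx (coord_dir R q) (connection h p) (F x).
  rewrite [LHS]exchange_big; apply: eq_bigr => p _; apply: eq_bigr => q _ /=.
  by congr (_ *: _); exact: mulrC.
have prod u v : pulled_connection u x *m pulled_connection v x
    = \sum_p \sum_q (J x u p * J x v q) *: (connection h p (F x) *m connection h q (F x)).
  rewrite /pulled_connection mulmx_suml; apply: eq_bigr => p _.
  rewrite mulmx_sumr; apply: eq_bigr => q _.
  by rewrite -scalemxAl -scalemxAr scalerA.
rewrite !prod [X in _ + (X - _)]exchange_big /=.
rewrite opprD [X in X + _]addrACA subrr add0r -!sumrB -big_split; apply: eq_bigr => p _ /=.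
rewrite -!sumrB -big_split; apply: eq_bigr => q _ /=.
by rewrite [J x b q * _]mulrC -!scalerBr -scalerDr.
Unshelve. all: by end_near. Qed.

(** Lowering an index with [g = J h J^T] cancels the Jacobian left over in
    [curvature_form_pullback]. *)
Theorem riemann_tensor_pullback x a b c d : A x ->
  riemann_tensor g a b c d x =
  tensor4 (fun p q r s => riemann_tensor h p q r s (F x))
    (row a (J x)) (row b (J x)) (row c (J x)) (row d (J x)).
Proof.
move=> Ax; have Bx := F_in Ax.
have congrE (K M : 'M[R]_n) : (K *m M *m K^T) d c = \sum_r \sum_s K c r * K d s * M s r.
  rewrite mxE; apply: eq_bigr => r _; rewrite [X in X * _]mxE mulr_suml.
  by apply: eq_bigr => s _; rewrite [X in _ * X]mxE; ring.
rewrite (riemann_tensorE gA) // (g_pullback Ax) /pullback_metric !mulmxA.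
rewrite curvature_form_pullback // -2!mulmxA [X in _ *m X]mulmxA mulmxA congrE.
rewrite /tensor4; under [RHS]eq_bigr => p _ do rewrite exchange_big /=.
rewrite [RHS]exchange_big /=; apply: eq_bigr => r _.
under [RHS]eq_bigr => p _ do rewrite exchange_big /=.
rewrite [RHS]exchange_big /=; apply: eq_bigr => s _.
rewrite mulmx_suml summxE mulr_sumr; apply: eq_bigr => p _.
rewrite mulmx_suml summxE mulr_sumr; apply: eq_bigr => q _.
rewrite -scalemxAl [X in _ * X]mxE -(riemann_tensorE hB p q r s Bx).
move: (riemann_tensor _ _ _ _ _ _) => T.
by rewrite ![row _ _ _ _]mxE; ring.
Qed.

End Transformation.

(** * Product metrics *)

Section LinearChange.
Variables (R : realType) (V V' W : normedModType R) (L : {linear V -> V'}).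

(** The difference quotients agree, so [f] may be an arbitrary function. *)
Lemma derive_linear (f : V' -> W) (v y : V) :
  'D_v (fun y => f (L y)) y = 'D_(L v) f (L y).
Proof.
rewrite /derive; set q1 := fun t => t^-1 *: _; set q2 := fun t => t^-1 *: _.
suff -> : q1 = q2 by []; rewrite funeqE /q1 /q2 => t /=.
by rewrite linearP.
Qed.

Lemma smooth_linear (A : set V') (f : V' -> W) :
  (forall y, differentiable L y) -> smooth_on A f ->
  smooth_on (L @^-1` A) (fun y => f (L y)).
Proof.
move=> dL sf s y Ay.
have -> : foldr (fun v g => 'D_v g) (fun y => f (L y)) s
        = (fun y => foldr (fun v g => 'D_v g) f (map L s) (L y)).
  elim: s => //= v s ->; rewrite funeqE => z.
  exact: (derive_linear (foldr (fun v g => 'D_v g) f (map L s)) v z).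
exact: (differentiable_comp (dL y) (sf (map L s) (L y) Ay)).
Qed.

Lemma smooth_cst (A : set V) (c : W) : smooth_on A (fun=> c).
Proof.
move=> s y Ay; suff [c' ->] : exists c', foldr (fun v g => 'D_v g) (fun=> c) s = cst c'.
  exact: differentiable_cst.
elim: s => [|v s [c' IH]] /=; first by exists c.
by exists 0; rewrite IH funeqE => z; rewrite derive_cst.
Qed.

End LinearChange.

Section ProductTensor.
Variables (R : realType) (k l : nat).
Variables (T1 : 'I_k -> 'I_k -> 'I_k -> 'I_k -> R) (T2 : 'I_l -> 'I_l -> 'I_l -> 'I_l -> R).

Definition sum_tensor (a b c d : 'I_(k + l)) : R :=
  match fintype.split a, fintype.split b, fintype.split c, fintype.split d with
  | inl a, inl b, inl c, inl d => T1 a b c d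
  | inr a, inr b, inr c, inr d => T2 a b c d
  | _, _, _, _ => 0
  end.

Lemma split_lshift (i : 'I_k) : fintype.split (lshift l i) = inl i.
Proof. exact: (unsplitK (inl i)). Qed.

Lemma split_rshift (i : 'I_l) : fintype.split (rshift k i) = inr i.
Proof. exact: (unsplitK (inr i)). Qed.

Lemma tensor4_sum (x y z w : 'rV[R]_(k + l)) :
  tensor4 sum_tensor x y z w =
  tensor4 T1 (lsubmx x) (lsubmx y) (lsubmx z) (lsubmx w)
  + tensor4 T2 (rsubmx x) (rsubmx y) (rsubmx z) (rsubmx w).
Proof.
pose E := (split_lshift, split_rshift, mulr0).
rewrite /tensor4 big_split_ord /=; congr (_ + _); apply: eq_bigr => p _.
  rewrite big_split_ord /= [X in _ + X]big1 => [|q _]; last first.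
    by rewrite big1 // => r _; rewrite big1 // => s _; rewrite /sum_tensor !E.
  rewrite addr0; apply: eq_bigr => q _.
  rewrite big_split_ord /= [X in _ + X]big1 => [|r _]; last first.
    by rewrite big1 // => s _; rewrite /sum_tensor !E.
  rewrite addr0; apply: eq_bigr => r _.
  rewrite big_split_ord /= [X in _ + X]big1 => [|s _]; last by rewrite /sum_tensor !E.
  by rewrite addr0; apply: eq_bigr => s _; rewrite !mxE /sum_tensor !E.
rewrite big_split_ord /= [X in X + _]big1 => [|q _]; last first.
  by rewrite big1 // => r _; rewrite big1 // => s _; rewrite /sum_tensor !E.
rewrite add0r; apply: eq_bigr => q _.
rewrite big_split_ord /= [X in X + _]big1 => [|r _]; last first.
  by rewrite big1 // => s _; rewrite /sum_tensor !E.
rewrite add0r; apply: eq_bigr => r _.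
rewrite big_split_ord /= [X in X + _]big1 => [|s _]; last by rewrite /sum_tensor !E.
by rewrite add0r; apply: eq_bigr => s _; rewrite !mxE /sum_tensor !E.
Qed.

End ProductTensor.

Lemma eq_block_diag (R : realType) p q (P P' : 'M[R]_p) (Q Q' : 'M[R]_q) :
  P = P' -> Q = Q' -> block_mx P 0 0 Q = block_mx P' 0 0 Q'.
Proof. by move=> -> ->. Qed.

Section ProductMetric.
Variables (R : realType) (k l : nat).
Variables (A1 : set 'rV[R]_k) (A2 : set 'rV[R]_l).
Variables (g1 : 'rV[R]_k -> 'M[R]_k) (g2 : 'rV[R]_l -> 'M[R]_l).
Hypotheses (gA1 : metric_on A1 g1) (gA2 : metric_on A2 g2).

Definition block_diag (p q : nat) (P : 'rV[R]_k -> 'M[R]_p) (Q : 'rV[R]_l -> 'M[R]_q)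
    (y : 'rV[R]_(k + l)) : 'M[R]_(p + q) :=
  block_mx (P (lsubmx y)) 0 0 (Q (rsubmx y)).

Definition prod_domain : set 'rV[R]_(k + l) := [set y | A1 (lsubmx y) /\ A2 (rsubmx y)].

Let lsub_diff (y : 'rV[R]_(k + l)) : differentiable (@lsubmx R 1 k l) y.
Proof. exact: differentiable_lsubmx. Qed.

Let rsub_diff (y : 'rV[R]_(k + l)) : differentiable (@rsubmx R 1 k l) y.
Proof. exact: differentiable_rsubmx. Qed.

Lemma prod_metric_on : metric_on prod_domain (block_diag g1 g2).
Proof.
split.
- apply: openI; apply: open_comp; try exact: (metric_on_open gA1); try exact: (metric_on_open gA2).
    by move=> y _; apply: differentiable_continuous; exact: lsub_diff.
  by move=> y _; apply: differentiable_continuous; exact: rsub_diff.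
- move=> i j; rewrite -[i]splitK -[j]splitK.
  case: (fintype.split i) => i'; case: (fintype.split j) => j' /= s y [A1y A2y].
  + have -> : (fun y => block_diag g1 g2 y (lshift l i') (lshift l j')) = (fun y => g1 (lsubmx y) i' j').
      by rewrite funeqE => z; rewrite block_mxEul.
    exact: (smooth_linear (L := @lsubmx R 1 k l) lsub_diff (metric_on_smooth gA1 i' j')).
  + have -> : (fun y => block_diag g1 g2 y (lshift l i') (rshift k j')) = (fun=> 0).
      by rewrite funeqE => z; rewrite block_mxEur mxE.
    exact: (smooth_cst (A := setT)).
  + have -> : (fun y => block_diag g1 g2 y (rshift k i') (lshift l j')) = (fun=> 0).
      by rewrite funeqE => z; rewrite block_mxEdl mxE.
    exact: (smooth_cst (A := setT)).
  + have -> : (fun y => block_diag g1 g2 y (rshift k i') (rshift k j')) = (fun y => g2 (rsubmx y) i' j').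
      by rewrite funeqE => z; rewrite block_mxEdr.
    exact: (smooth_linear (L := @rsubmx R 1 k l) rsub_diff (metric_on_smooth gA2 i' j')).
- move=> y [A1y A2y]; rewrite /block_diag tr_block_mx !trmx0.
  by rewrite (metric_on_sym gA1) // (metric_on_sym gA2).
- move=> y v [A1y A2y] v0.
  have ge1 (u : 'rV[R]_k) : 0 <= (u *m g1 (lsubmx y) *m u^T) 0 0.
    have [->|u0] := eqVneq u 0; first by rewrite !mul0mx mxE.
    by rewrite ltW // (metric_on_posdef gA1).
  have ge2 (u : 'rV[R]_l) : 0 <= (u *m g2 (rsubmx y) *m u^T) 0 0.
    have [->|u0] := eqVneq u 0; first by rewrite !mul0mx mxE.
    by rewrite ltW // (metric_on_posdef gA2).
  move: v0; rewrite -[v]hsubmxK /block_diag mul_row_block !mulmx0 addr0 add0r.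
  rewrite tr_row_mx mul_row_col mxE => v0.
  have [v1|v1] := eqVneq (lsubmx v) 0; last by rewrite ltr_wpDr // (metric_on_posdef gA1).
  rewrite ltr_wpDl // (metric_on_posdef gA2) //.
  by apply: contraNneq v0 => v2; rewrite v1 v2 row_mx0.
Qed.

Lemma lsubmx_coord_lshift (i : 'I_k) :
  lsubmx (coord_dir R (lshift l i) : 'rV_(k + l)) = coord_dir R i.
Proof. by apply/rowP => j; rewrite !mxE eq_lshift. Qed.

Lemma rsubmx_coord_lshift (i : 'I_k) :
  rsubmx (coord_dir R (lshift l i) : 'rV_(k + l)) = 0.
Proof. by apply/rowP => j; rewrite !mxE eq_rlshift andbF. Qed.

Lemma lsubmx_coord_rshift (i : 'I_l) :
  lsubmx (coord_dir R (rshift k i) : 'rV_(k + l)) = 0.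
Proof. by apply/rowP => j; rewrite !mxE eq_lrshift andbF. Qed.

Lemma rsubmx_coord_rshift (i : 'I_l) :
  rsubmx (coord_dir R (rshift k i) : 'rV_(k + l)) = coord_dir R i.
Proof. by apply/rowP => j; rewrite !mxE eq_rshift. Qed.

Lemma dmx_dir0 (V : normedModType R) p q (P : V -> 'M[R]_(p, q)) y : dmx 0 P y = 0.
Proof. by apply/matrixP => i j; rewrite dmxE derive0 mxE. Qed.

Lemma dmx_cst0 m p q (v y : 'rV[R]_m) : dmx v (fun=> 0 : 'M[R]_(p, q)) y = 0.
Proof.
apply/matrixP => i j; rewrite dmxE [RHS]mxE.
have -> : (fun _ : 'rV[R]_m => (0 : 'M[R]_(p, q)) i j) = cst 0.
  by rewrite funeqE => z; rewrite mxE.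
exact: derive_cst.
Qed.

Lemma dmx_block p q (P : 'rV[R]_k -> 'M[R]_p) (Q : 'rV[R]_l -> 'M[R]_q) v y :
  dmx v (block_diag P Q) y =
  block_mx (dmx (lsubmx v) P (lsubmx y)) 0 0 (dmx (rsubmx v) Q (rsubmx y)).
Proof.
apply/matrixP => i j; rewrite dmxE -[i]splitK -[j]splitK.
case: (fintype.split i) => i'; case: (fintype.split j) => j' /=.
- rewrite block_mxEul dmxE.
  have -> : (fun y => block_diag P Q y (lshift q i') (lshift q j')) = (fun y => P (lsubmx y) i' j').
    by rewrite funeqE => z; rewrite block_mxEul.
  exact: (derive_linear (@lsubmx R 1 k l) (fun z => P z i' j')).
- rewrite block_mxEur mxE.
  have -> : (fun y => block_diag P Q y (lshift q i') (rshift p j')) = cst 0.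
    by rewrite funeqE => z; rewrite block_mxEur mxE.
  exact: derive_cst.
- rewrite block_mxEdl mxE.
  have -> : (fun y => block_diag P Q y (rshift p i') (lshift q j')) = cst 0.
    by rewrite funeqE => z; rewrite block_mxEdl mxE.
  exact: derive_cst.
- rewrite block_mxEdr dmxE.
  have -> : (fun y => block_diag P Q y (rshift p i') (rshift p j')) = (fun y => Q (rsubmx y) i' j').
    by rewrite funeqE => z; rewrite block_mxEdr.
  exact: (derive_linear (@rsubmx R 1 k l) (fun z => Q z i' j')).
Qed.

Definition left_connection (a : 'I_(k + l)) : 'rV[R]_k -> 'M[R]_k :=
  if fintype.split a is inl i then connection g1 i else fun=> 0.

Definition right_connection (a : 'I_(k + l)) : 'rV[R]_l -> 'M[R]_l :=
  if fintype.split a is inr i then connection g2 i else fun=> 0.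

(** By uniqueness it is enough that the block connection is symmetric and compatible
    with the block metric, which is checked in each factor. *)
Lemma connection_prod y a : prod_domain y ->
  connection (block_diag g1 g2) a y =
  block_diag (left_connection a) (right_connection a) y.
Proof.
move=> Ay; have [A1y A2y] := Ay; have hA := prod_metric_on.
pose G a := block_diag (left_connection a) (right_connection a) y.
apply: (connection_unique (G := G) (metric_on_sym hA Ay) (metric_on_unitmx hA Ay)).
  move=> {}a; rewrite dmx_block /G /block_diag tr_block_mx !trmx0 !mulmx_block.
  rewrite !(mulmx0, mul0mx, addr0, add0r) add_block_mx !addr0.
  rewrite -[a]splitK /left_connection /right_connection unsplitK.
  case: (fintype.split a) => i /=.
    rewrite lsubmx_coord_lshift rsubmx_coord_lshift dmx_dir0.
    by rewrite (connection_metric gA1 i A1y) trmx0 mul0mx mulmx0 addr0.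
  rewrite lsubmx_coord_rshift rsubmx_coord_rshift dmx_dir0.
  by rewrite (connection_metric gA2 i A2y) trmx0 mul0mx mulmx0 addr0.
move=> {}a b c; rewrite /G /block_diag /left_connection /right_connection.
rewrite -[a]splitK -[b]splitK -[c]splitK.
case: (fintype.split a) => a'; case: (fintype.split b) => b'; case: (fintype.split c) => c';
  rewrite /= ?split_lshift ?split_rshift.
- rewrite [LHS]block_mxEul [RHS]block_mxEul [LHS]mxE [RHS]mxE.
  exact: (christoffel_sym gA1).
- by rewrite [LHS]block_mxEur [RHS]block_mxEur [LHS]mxE [RHS]mxE.
- by rewrite [LHS]block_mxEdl [RHS]block_mxEul [LHS]mxE [RHS]mxE.
- by rewrite [LHS]block_mxEdr [RHS]block_mxEur [LHS]mxE [RHS]mxE.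
- by rewrite [LHS]block_mxEul [RHS]block_mxEdl [LHS]mxE [RHS]mxE.
- by rewrite [LHS]block_mxEur [RHS]block_mxEdr [LHS]mxE [RHS]mxE.
- by rewrite [LHS]block_mxEdl [RHS]block_mxEdl [LHS]mxE [RHS]mxE.
- rewrite [LHS]block_mxEdr [RHS]block_mxEdr [LHS]mxE [RHS]mxE.
  exact: (christoffel_sym gA2).
Qed.

(** A mixed component vanishes because the symbols of one factor are constant in the
    directions of the other and the corresponding blocks multiply to zero. *)
Lemma curvature_form_prod y a b : prod_domain y ->
  curvature_form (block_diag g1 g2) a b y =
  match fintype.split a, fintype.split b with
  | inl a, inl b => block_mx (curvature_form g1 a b (lsubmx y)) 0 0 0
  | inr a, inr b => block_mx 0 0 0 (curvature_form g2 a b (rsubmx y))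
  | _, _ => 0
  end.
Proof.
move=> Ay.
have dC u v : dmx (coord_dir R u) (connection (block_diag g1 g2) v) y
    = block_mx (dmx (lsubmx (coord_dir R u)) (left_connection v) (lsubmx y)) 0 0
               (dmx (rsubmx (coord_dir R u)) (right_connection v) (rsubmx y)).
  rewrite -dmx_block; apply: dmx_near; near=> z; apply: connection_prod.
  near: z; exact: (near_open prod_metric_on).
rewrite /curvature_form !dC !connection_prod // /block_diag !mulmx_block.
rewrite !(mulmx0, mul0mx, addr0, add0r) !opp_block_mx !add_block_mx !(oppr0, addr0).
rewrite /left_connection /right_connection.
rewrite -[a]splitK -[b]splitK !unsplitK.
case: (fintype.split a) => a'; case: (fintype.split b) => b' /=.
- apply: eq_block_diag; first by rewrite !lsubmx_coord_lshift.
  by rewrite !rsubmx_coord_lshift dmx_dir0 mulmx0 !subrr addr0.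
- apply: (etrans (eq_block_diag (P' := 0) (Q' := 0) _ _)); last exact: block_mx0.
    by rewrite lsubmx_coord_lshift lsubmx_coord_rshift dmx_cst0 dmx_dir0 mul0mx mulmx0 !subrr addr0.
  by rewrite rsubmx_coord_lshift rsubmx_coord_rshift dmx_dir0 dmx_cst0 mul0mx mulmx0 !subrr addr0.
- apply: (etrans (eq_block_diag (P' := 0) (Q' := 0) _ _)); last exact: block_mx0.
    by rewrite lsubmx_coord_lshift lsubmx_coord_rshift dmx_dir0 dmx_cst0 mul0mx mulmx0 !subrr addr0.
  by rewrite rsubmx_coord_lshift rsubmx_coord_rshift dmx_cst0 dmx_dir0 mul0mx mulmx0 !subrr addr0.
- apply: eq_block_diag; last by rewrite !rsubmx_coord_rshift.
  by rewrite !lsubmx_coord_rshift dmx_dir0 mulmx0 !subrr addr0.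
Unshelve. all: by end_near. Qed.

Lemma riemann_tensor_prod y a b c d : prod_domain y ->
  riemann_tensor (block_diag g1 g2) a b c d y =
  sum_tensor (fun a b c d => riemann_tensor g1 a b c d (lsubmx y))
             (fun a b c d => riemann_tensor g2 a b c d (rsubmx y)) a b c d.
Proof.
move=> Ay; have [A1y A2y] := Ay.
rewrite (riemann_tensorE prod_metric_on) // curvature_form_prod // /sum_tensor.
case: (fintype.split a) => a'; case: (fintype.split b) => b';
  [| by rewrite mul0mx mxE | by rewrite mul0mx mxE |].
  rewrite /block_diag mulmx_block !(mulmx0, mul0mx, addr0, add0r).
  rewrite -[d]splitK -[c]splitK !unsplitK.
  case: (fintype.split c) => c'; case: (fintype.split d) => d' /=.
  - by rewrite block_mxEul (riemann_tensorE gA1).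
  - by rewrite block_mxEdl mxE.
  - by rewrite block_mxEur mxE.
  - by rewrite block_mxEdr mxE.
rewrite /block_diag mulmx_block !(mulmx0, mul0mx, addr0, add0r).
rewrite -[d]splitK -[c]splitK !unsplitK.
case: (fintype.split c) => c'; case: (fintype.split d) => d' /=.
- by rewrite block_mxEul mxE.
- by rewrite block_mxEdl mxE.
- by rewrite block_mxEur mxE.
- by rewrite block_mxEdr (riemann_tensorE gA2).
Qed.

End ProductMetric.

(** * A metric that is locally a pull-back of a product *)

Section TensorPullback.
Variables (R : realType) (n m : nat).
Implicit Types (T : 'I_m -> 'I_m -> 'I_m -> 'I_m -> R).

Lemma tensor4_row0 T y z w : tensor4 T 0 y z w = 0.
Proof. by have := tensor4_1 T 1 0 0 y z w; rewrite scale1r addr0; lra. Qed.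

Lemma tensor4_mulmx T (J : 'M[R]_(n, m)) (x y z w : 'rV[R]_n) :
  tensor4 (fun p q r s => tensor4 T (row p J) (row q J) (row r J) (row s J)) x y z w
  = tensor4 T (x *m J) (y *m J) (z *m J) (w *m J).
Proof.
have lin (f : 'rV[R]_m -> R) (u : 'rV[R]_n) :
    (forall a v v', f (a *: v + v') = a * f v + f v') ->
    f (u *m J) = \sum_p u 0 p * f (row p J).
  move=> f_lin; have f0 : f 0 = 0 by have := f_lin 1 0 0; rewrite scale1r addr0; lra.
  rewrite mulmx_sum_row; elim/big_rec2: _ => [//|p v c _ <-].
  by rewrite f_lin.
rewrite (lin (fun v => tensor4 T v _ _ _)); last by move=> *; exact: tensor4_1.
apply: eq_bigr => p _.
rewrite (lin (fun v => tensor4 T _ v _ _)); last by move=> *; exact: tensor4_2.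
rewrite mulr_sumr; apply: eq_bigr => q _.
rewrite (lin (fun v => tensor4 T _ _ v _)); last by move=> *; exact: tensor4_3.
rewrite !mulr_sumr; apply: eq_bigr => r _.
rewrite (lin (fun v => tensor4 T _ _ _ v)); last by move=> *; exact: tensor4_4.
by rewrite !mulr_sumr; apply: eq_bigr => s _; rewrite !mulrA.
Qed.

Lemma eq_tensor4 T T' x y z w : (forall p q r s, T p q r s = T' p q r s) ->
  tensor4 T x y z w = tensor4 T' x y z w.
Proof. by move=> E; do 4! [apply: eq_bigr => ? _]; rewrite E. Qed.

Lemma tensor4_eq0 T x y z w : (forall p q r s, T p q r s = 0) -> tensor4 T x y z w = 0.
Proof.
move=> T0; rewrite /tensor4; do 4! [apply: big1 => ? _].
by rewrite T0 mulr0.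
Qed.

End TensorPullback.

Section LocalSplitting.
Variables (R : realType) (k l : nat) (alpha sgn : R).
Variables (A : set 'rV[R]_(k + l)) (A1 : set 'rV[R]_k) (A2 : set 'rV[R]_l).
Variables (g : 'rV[R]_(k + l) -> 'M[R]_(k + l)).
Variables (g1 : 'rV[R]_k -> 'M[R]_k) (g2 : 'rV[R]_l -> 'M[R]_l).
Variables (F : 'rV[R]_(k + l) -> 'rV[R]_(k + l)) (x : 'rV[R]_(k + l)).
Hypotheses (k0 : (0 < k)%N) (l0 : (0 < l)%N) (alpha_ge1 : 1 <= alpha).
Hypothesis alpha_le : alpha <= (dimS20 (k + l))%:R.
Hypothesis alpha_lt : alpha < (k * l)%:R + (2 * k * l)%:R / (k + l)%:R.
Hypotheses (gA : metric_on A g) (gA1 : metric_on A1 g1) (gA2 : metric_on A2 g2).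
Hypothesis F_smooth : smooth_on A F.
Hypothesis F_in : forall y, A y -> prod_domain A1 A2 (F y).
Hypothesis g_pullback : forall y, A y -> g y = pullback_metric F (block_diag g1 g2) y.
Hypothesis Ax : A x.
Hypothesis sgn_neq0 : sgn != 0.
Hypothesis sums_ge0 : forall E phi, orthonormal_frame g x E -> orthonormal_basis_S20 phi ->
  0 <= sgn * alpha_sum alpha (riemann_in_frame g E x) phi.

Local Notation J := (jacobian F x).
Local Notation x1 := (lsubmx (F x)).
Local Notation x2 := (rsubmx (F x)).
Local Notation Rm1 := (fun a b c d => riemann_tensor g1 a b c d x1).
Local Notation Rm2 := (fun a b c d => riemann_tensor g2 a b c d x2).

Let A1x : A1 x1. Proof. by have [] := F_in Ax. Qed.
Let A2x : A2 x2. Proof. by have [] := F_in Ax. Qed.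
Let hA := prod_metric_on gA1 gA2.

(** The curvature of [g] is pulled back from the product, hence the sum of the
    curvatures of the factors evaluated on the components of the images. *)
Lemma tensor4_riemann_split u v w z :
  tensor4 (fun a b c d => riemann_tensor g a b c d x) u v w z =
  tensor4 Rm1 (lsubmx (u *m J)) (lsubmx (v *m J)) (lsubmx (w *m J)) (lsubmx (z *m J))
  + tensor4 Rm2 (rsubmx (u *m J)) (rsubmx (v *m J)) (rsubmx (w *m J)) (rsubmx (z *m J)).
Proof.
rewrite -tensor4_sum -tensor4_mulmx; apply: eq_tensor4 => p q r s.
rewrite (riemann_tensor_pullback gA hA F_smooth F_in g_pullback _ _ _ _ Ax).
by apply: eq_tensor4 => a b c d; exact: (riemann_tensor_prod gA1 gA2 a b c d (F_in Ax)).
Qed.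

Lemma riemann_in_frameE E a b c d : riemann_in_frame g E x a b c d =
  tensor4 (fun a b c d => riemann_tensor g a b c d x) (row a E) (row b E) (row c E) (row d E).
Proof. by do 4! [apply: eq_bigr => ? _]; rewrite ![row _ _ _ _]mxE. Qed.

(** Orthonormal frames of the two factors together pull back to an orthonormal frame
    for [g], in which the components of the curvature satisfy the assumptions of
    [split_sectional_eq0]. *)
Lemma adapted_frame_sectional (E1 : 'M[R]_k) (E2 : 'M[R]_l) :
  E1 *m g1 x1 *m E1^T = 1%:M -> E2 *m g2 x2 *m E2^T = 1%:M ->
  (forall a b, tensor4 Rm1 (row a E1) (row b E1) (row a E1) (row b E1) = 0) /\
  (forall a b, tensor4 Rm2 (row a E2) (row b E2) (row a E2) (row b E2) = 0).
Proof.
move=> oE1 oE2.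
(* The rows of E are the vectors that the differential of F maps to the rows of D. *)
pose D := block_mx E1 0 0 E2; pose E := D *m invmx J.
have gx := g_pullback Ax.
have JU : J \in unitmx.
  have := metric_on_unitmx gA Ax; rewrite gx.
  by rewrite /pullback_metric !unitmx_mul => /andP[/andP[]].
have EJ : E *m J = D by rewrite mulmxKV.
have oE : orthonormal_frame g x E.
  rewrite /orthonormal_frame gx /pullback_metric !mulmxA EJ -mulmxA -trmx_mul EJ.
  rewrite /D /block_diag tr_block_mx !mulmx_block !trmx0 !(mulmx0, mul0mx, addr0, add0r).
  by rewrite oE1 oE2 -scalar_mx_block.
have rowE a : row a E *m J = row a D by rewrite -row_mul EJ.
have rowl i : row (lshift l i) D = row_mx (row i E1) 0.
  by rewrite /D /block_mx rowKu row_row_mx row0.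
have rowr i : row (rshift k i) D = row_mx 0 (row i E2).
  by rewrite /D /block_mx rowKd row_row_mx row0.
pose T a b c d := sgn * riemann_in_frame g E x a b c d.
have TE a b c d : T a b c d = sgn *
    (tensor4 Rm1 (lsubmx (row a D)) (lsubmx (row b D)) (lsubmx (row c D)) (lsubmx (row d D))
   + tensor4 Rm2 (rsubmx (row a D)) (rsubmx (row b D)) (rsubmx (row c D)) (rsubmx (row d D))).
  by rewrite /T riemann_in_frameE tensor4_riemann_split !rowE.
have T0 : forall a b, T a b a b = 0.
  apply: (split_sectional_eq0 k0 l0 alpha_ge1 alpha_le alpha_lt) => [a b c d|a b c d|i j|phi oP].
  - rewrite /T !riemann_in_frameE tensor4_anti12 ?mulrN // => p q r s.
    exact: (riemann_anti12 gA).
  - rewrite /T !riemann_in_frameE tensor4_anti34 ?mulrN // => p q r s.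
    exact: (riemann_anti34 gA).
  - rewrite TE rowl rowr !row_mxKl !row_mxKr tensor4_row0.
    rewrite tensor4_anti12 ?tensor4_row0 ?oppr0 ?addr0 ?mulr0 // => p q r s.
    exact: (riemann_anti12 gA1).
  - have -> : alpha_sum alpha T phi = sgn * alpha_sum alpha (riemann_in_frame g E x) phi.
      rewrite /alpha_sum mulrDr mulrCA; congr (_ + _ * _); rewrite mulr_sumr;
      by apply: eq_bigr => i _; exact: second_kind_scale.
    exact: sums_ge0.
split=> a b.
  have := T0 (lshift l a) (lshift l b); rewrite TE !rowl !row_mxKl !row_mxKr tensor4_row0 addr0.
  by move/eqP; rewrite mulf_eq0 (negbTE sgn_neq0) => /eqP.
have := T0 (rshift k a) (rshift k b); rewrite TE !rowr !row_mxKl !row_mxKr tensor4_row0 add0r.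
by move/eqP; rewrite mulf_eq0 (negbTE sgn_neq0) => /eqP.
Qed.

(** Every orthonormal pair in one factor belongs to some orthonormal frame of that
    factor, so all sectional curvatures vanish and polarization applies. *)
Lemma factors_flat : (forall a b c d, Rm1 a b c d = 0) /\ (forall a b c d, Rm2 a b c d = 0).
Proof.
have g1T := metric_on_sym gA1 A1x; have g2T := metric_on_sym gA2 A2x.
have g1P v := metric_on_posdef gA1 (v := v) A1x.
have g2P v := metric_on_posdef gA2 (v := v) A2x.
have frame (n : nat) (h : 'M[R]_n) (u v : 'rV[R]_n) : h^T = h ->
    (forall v : 'rV[R]_n, v != 0 -> 0 < (v *m h *m v^T) 0 0) ->
    gram_form h u u = 1 -> gram_form h v v = 1 -> gram_form h u v = 0 ->
    exists E : 'M[R]_n, [/\ E *m h *m E^T = 1%:M, exists a, row a E = u & exists b, row b E = v].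
  move=> hT hP uu vv uv.
  have [|E oE rE] := @frame_complete R n h hT hP [:: u; v].
    have uv_neq : u != v by apply: contraTneq isT => E;
      move: uu; rewrite {2}E uv => /esym/eqP; rewrite oner_eq0.
    split; first by rewrite /= inE uv_neq.
    move=> a b; rewrite !inE => /orP[] /eqP-> /orP[] /eqP->;
      rewrite ?eqxx ?uu ?vv ?uv ?(negbTE uv_neq) //.
    by rewrite gram_formC // uv eq_sym (negbTE uv_neq).
  by exists E; split => //; apply: rE; rewrite !inE eqxx ?orbT.
have any (n : nat) (h : 'M[R]_n) : h^T = h ->
    (forall v : 'rV[R]_n, v != 0 -> 0 < (v *m h *m v^T) 0 0) ->
    exists E : 'M[R]_n, E *m h *m E^T = 1%:M.
  move=> hT hP; have [|E oE _] := @frame_complete R n h hT hP [::]; last by exists E.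
  by split.
split.
  apply: sectional_zero_curvature_zero => [a b c d|a b c d|a b c d|].
  - exact: (riemann_anti12 gA1).
  - exact: (riemann_anti34 gA1).
  - exact: (riemann_bianchi gA1).
  apply: (tensor4_sectional_eq0 _ _ g1T g1P) => [a b c d|a b c d|u v uu vv uv].
  - exact: (riemann_anti12 gA1).
  - exact: (riemann_anti34 gA1).
  have [E1 [oE1 [a <-] [b <-]]] := frame _ _ _ _ g1T g1P uu vv uv.
  have [E2 oE2] := any _ _ g2T g2P.
  by have [H _] := adapted_frame_sectional oE1 oE2; exact: H.
apply: sectional_zero_curvature_zero => [a b c d|a b c d|a b c d|].
- exact: (riemann_anti12 gA2).
- exact: (riemann_anti34 gA2).
- exact: (riemann_bianchi gA2).
apply: (tensor4_sectional_eq0 _ _ g2T g2P) => [a b c d|a b c d|u v uu vv uv].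
- exact: (riemann_anti12 gA2).
- exact: (riemann_anti34 gA2).
have [E2 [oE2 [a <-] [b <-]]] := frame _ _ _ _ g2T g2P uu vv uv.
have [E1 oE1] := any _ _ g1T g1P.
by have [_ H] := adapted_frame_sectional oE1 oE2; exact: H.
Qed.

Lemma split_riemann_eq0 a b c d : riemann_tensor g a b c d x = 0.
Proof.
have [R10 R20] := factors_flat.
rewrite -(tensor4_delta (fun a b c d => riemann_tensor g a b c d x)) tensor4_riemann_split.
by rewrite (tensor4_eq0 _ _ _ _ R10) (tensor4_eq0 _ _ _ _ R20) addr0.
Qed.

End LocalSplitting.

(** * From charts to the theorem *)

Section Charts.
Variables (R : realType).

Lemma smooth_on_subset (V W : normedModType R) (A B : set V) (f : V -> W) :
  A `<=` B -> smooth_on B f -> smooth_on A f.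
Proof. by move=> AB sf s y /AB; exact: sf. Qed.

Definition transition_domain (n m : nat) (M : riemann_data R n) (N : riemann_data R m)
    (U : set M) (f : M -> N) (i : chart_index M) (j : chart_index N) : set 'rV[R]_n :=
  chart i @` (U `&` chart_dom i `&` f @^-1` chart_dom j).

Lemma transition_domain_open (n m : nat) (M : riemann_data R n) (N : riemann_data R m)
    (U : set M) (f : M -> N) (i : chart_index M) (j : chart_index N) :
  is_riemannian M -> open U -> open (chart_dom j) ->
  (forall p, U p -> {for p, continuous f}) ->
  open (transition_domain U f i j).
Proof.
move=> rM oU oj cf; rewrite openE => _ [p [[Up ip] jfp] <-].
have im_p : (chart i @` chart_dom i) (chart i p) by exists p.
have nP : nbhs p (U `&` f @^-1` chart_dom j).
  apply: filterI; first exact: open_nbhs_nbhs.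
  by apply: (cf p Up); exact: open_nbhs_nbhs.
have cinv := riem_chart_inv_continuous rM im_p.
have n1 : nbhs (chart i p) (chart_inv i @^-1` (U `&` f @^-1` chart_dom j)).
  by apply: cinv; rewrite (riem_chartK rM ip).
have n2 : nbhs (chart i p) (chart i @` chart_dom i).
  by apply: open_nbhs_nbhs; split => //; exact: riem_image_open.
apply: filterS (filterI n1 n2) => y [[Uy fy] [q iq qy]].
rewrite -qy /= in Uy fy *; rewrite (riem_chartK rM iq) in Uy fy.
by exists q.
Qed.

Lemma metric_on_chart (n : nat) (M : riemann_data R n) (i : chart_index M) (A : set 'rV[R]_n) :
  is_riemannian M -> open A -> A `<=` chart i @` chart_dom i -> metric_on A (metric i).
Proof.
move=> rM oA AI; split => //.
- move=> a b; apply: smooth_on_subset AI _.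
  exact: (smooth_entry a b (riem_image_open rM (i := i)) (riem_metric_smooth rM (i := i))).
- by move=> x /AI; exact: riem_metric_sym.
- by move=> x v /AI; exact: riem_metric_posdef.
Qed.

End Charts.

(** Near [p] the isometry, written in charts, exhibits the metric of [M] as the
    pull-back of a block metric; a sign covers both curvature hypotheses. *)
Lemma riemann_tensor_eq0_of_isometric (R : realType) (k l : nat) (alpha sgn : R)
    (M : riemann_data R (k + l)) (U : set M) (M1 : riemann_data R k) (M2 : riemann_data R l)
    (p : M) (i : chart_index M) :
  (0 < k)%N -> (0 < l)%N -> 1 <= alpha -> alpha <= (dimS20 (k + l))%:R ->
  alpha < (k * l)%:R + (2 * k * l)%:R / (k + l)%:R ->
  is_riemannian M -> is_riemannian M1 -> is_riemannian M2 ->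
  open U -> U p -> isometric U (prod_riemann M1 M2) -> chart_dom i p ->
  sgn != 0 ->
  (forall E phi, orthonormal_frame (metric i) (chart i p) E -> orthonormal_basis_S20 phi ->
    0 <= sgn * alpha_sum alpha (riemann_in_frame (metric i) E (chart i p)) phi) ->
  forall a b c d, riemann_tensor (metric i) a b c d (chart i p) = 0.
Proof.
move=> k0 l0 a1 aN alt rM rM1 rM2 oU Up [f [h [_ _ [cf sf] _ isoE]]] ip s0 sums a b c d.
have [j1 j1P] := riem_cover rM1 (f p).1; have [j2 j2P] := riem_cover rM2 (f p).2.
pose j : chart_index (prod_riemann M1 M2) := (j1, j2).
pose A := transition_domain U f i j.
have oj : open (chart_dom j).
  rewrite openE => -[q1 q2] [/= q1j q2j]; exists (chart_dom j1, chart_dom j2) => //.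
  by split; apply: open_nbhs_nbhs; split => //; exact: riem_dom_open.
have oA : open A by exact: transition_domain_open.
have AI : A `<=` chart i @` chart_dom i by move=> _ [q [[_ iq] _] <-]; exists q.
have gA : metric_on A (metric i) by exact: metric_on_chart.
have gA1 : metric_on (chart j1 @` chart_dom j1) (metric j1).
  by apply: metric_on_chart => //; exact: riem_image_open.
have gA2 : metric_on (chart j2 @` chart_dom j2) (metric j2).
  by apply: metric_on_chart => //; exact: riem_image_open.
have F_in y : A y -> prod_domain (chart j1 @` chart_dom j1) (chart j2 @` chart_dom j2)
    (in_charts f i j y).
  move=> [q [[_ iq] [jq1 jq2]] <-]; rewrite /in_charts (riem_chartK rM iq) /=.
  by split; rewrite ?row_mxKl ?row_mxKr; [exists (f q).1|exists (f q).2].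
apply: (split_riemann_eq0 k0 l0 a1 aN alt gA gA1 gA2 (sf i j) F_in _ _ s0 sums).
- by move=> y Ay; exact: isoE.
- by exists p => //; split=> //; split.
Qed.

(** The factors have dimensions [k] and [n - k]; replacing [n] by their sum puts
    the block matrices of the product in the same type as the metric of [M]. *)
Theorem theorem1p6 (R : realType) (n k : nat) (M : riemann_data R n)
    (alpha : R) :
  is_riemannian M ->
  (1 <= k)%N -> (2 * k <= n)%N ->
  1 <= alpha -> alpha <= (dimS20 n)%:R ->
  alpha < (k * (n - k))%:R + (2 * k * (n - k))%:R / n%:R ->
  alpha_nonnegative M alpha \/ alpha_nonpositive M alpha ->
  locally_splits M k ->
  flat M.
Proof.
move=> rM k0 kn a1 aN alt sgn_alpha splits p i a b c d ip.
have [U [oU Up [M1 [M2 [rM1 rM2 iso]]]]] := splits p.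
have l0 : (0 < n - k)%N by rewrite subn_gt0; move: kn; lia.
have En : (k + (n - k))%N = n by rewrite subnKC //; move: kn; lia.
clear splits kn.
move: (n - k)%N En l0 M2 alt rM2 iso => l En; subst n => l0 M2 alt rM2 iso.
(* A nonpositive curvature operator is handled through the opposite tensor. *)
have [sgn s0 sums] : exists2 sgn : R, sgn != 0 & forall E phi,
    orthonormal_frame (metric i) (chart i p) E -> orthonormal_basis_S20 phi ->
    0 <= sgn * alpha_sum alpha (riemann_in_frame (metric i) E (chart i p)) phi.
  case: sgn_alpha => H; [exists 1|exists (-1)]; rewrite ?oner_eq0 ?oppr_eq0 ?oner_eq0 //.
    by move=> E phi oE oP; rewrite mul1r; exact: H.
  by move=> E phi oE oP; rewrite mulN1r oppr_ge0; exact: H.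
exact: (riemann_tensor_eq0_of_isometric k0 l0 a1 aN alt rM rM1 rM2 oU Up iso ip s0 sums).
Qed.
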